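(* Let $n\geq 1$, let $\mathsf{s}=\mathrm{diag}(1,0,\ldots,0)\in \mathfrak{gl}_n(\mathbb{C})$, and let $h:[n]\to[n]$ be any Hessenberg function with set of corners $\mathcal{C}(h)$. Then the minimal semisimple Hessenberg variety $Y_{\mathsf{s},h}$ (as a closed subscheme of $G/B$) is equal to a reduced union of Richardson varieties, $$Y_{\mathsf{s},h}=\bigcup_{i\in\mathcal{C}(h)}\left(X_{u[i]}^{\mathrm{op}}\cap X_{w_0v[h(i)]}\right).$$
   Context: Let $[n]=\{1,\dots,n\}$, $G=GL_n(\mathbb{C})$, $B\subset G$ the upper triangular matrices, $B_-\subset G$ the lower triangular matrices, $\pi:G\to G/B$ the projection. $G/B$ is identified with complete flags $V_\bullet=(0\subset V_1\subset\cdots\subset V_n=\mathbb{C}^n)$, where $gB$ corresponds to the flag with $V_i$ spanned by the first $i$ columns of $g$. Permutations: for $w\in S_n$, $\dot w$ is the permutation matrix with entry $1$ in row $i$, column $j$ iff $w(j)=i$. $w_0$ is the longest element of $S_n$; $\ell(w)$ is the number of inversions, and ''shortest'' means of minimal length. Schubert variety: $X_w=\overline{B\dot wB/B}$; opposite Schubert variety: $X_w^{\mathrm{op}}=\overline{B_-\dot wB/B}$ (both reduced subvarieties of $G/B$). A Richardson variety is an intersection $X_u^{\mathrm{op}}\cap X_v$. For $k\in[n]$, $u[k]$ is the shortest permutation $u\in S_n$ with $u(k)=1$, and $v[k]$ is the shortest permutation $v\in S_n$ with $v(k)=n$. A Hessenberg function is a map $h:[n]\to[n]$ with $h(i)\ge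 i$ for all $i$ and $h(i-1)\le h(i)$ for $2\le i\le n$; by convention $h(0)=0$. Its corner set is $\mathcal{C}(h)=\{i\in[n]: h(i)>h(i-1)\}$. For $\mathsf{x}\in\mathfrak{gl}_n(\mathbb{C})$, the Hessenberg variety is $Y_{\mathsf{x},h}=\{V_\bullet: \mathsf{x}(V_i)\subseteq V_{h(i)}\text{ for all } i\}$, with the following (a priori possibly non-reduced) scheme structure. Let $\mathbf z=\{z_{ij}\}_{1\le i,j\le n}$ be variables, $Z=(z_{ij})$ the generic matrix with columns $v_1,\dots,v_n$. For $i$ with $h(i)<n$ let $\mathcal{I}_{\mathsf{x},h,i}\subseteq\mathbb{C}[\mathbf z]$ be the ideal generated by all $(h(i)+1)\times(h(i)+1)$ minors of the $n\times(i+h(i))$ matrix $[\mathsf{x}v_1\,|\cdots|\,\mathsf{x}v_i\,|\,v_1\,|\cdots|\,v_{h(i)}]$; if $h(i)=n$ let $\mathcal{I}_{\mathsf{x},h,i}=0$. Put $\mathcal{I}_{\mathsf{x},h}=\sum_{i\in[n]}\mathcal{I}_{\mathsf{x},h,i}$. Then $Y_{\mathsf{x},h}$ is the closed subscheme of $G/B$ such that $\pi^{-1}(Y_{\mathsf{x},h})=GL_n(\mathbb{C})\cap\mathrm{Spec}(\mathbb{C}[\mathbf z]/\mathcal{I}_{\mathsf{x},h})$. ''Reduced union'' means that the scheme $Y_{\mathsf{s},h}$ is reduced and equals the stated union. *)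

(* Defs.v *)
From HB Require Import structures.
From mathcomp Require Import all_boot all_order all_fingroup all_algebra.
From mathcomp Require Import mpoly complex.
From mathcomp Require Import boolp classical_sets reals.

Set Implicit Arguments.
Unset Strict Implicit.
Unset Printing Implicit Defensive.

Import GRing.Theory.
Local Open Scope ring_scope.
Local Open Scope classical_set_scope.

(* Throughout, [n] = {1, ..., n} is 'I_n = {0, ..., n-1}: indices, values of
   permutations and values of Hessenberg functions are all shifted by one. *)

Section Permutations.
Variable n : nat.
Implicit Types (w : 'S_n) (k : 'I_n).

Definition perm_len w : nat :=
  #|[set p : 'I_n * 'I_n | (p.1 < p.2)%N && (w p.2 < w p.1)%N]%SET|.

Definition longest_perm : 'S_n := [arg max_(w > 1%g) perm_len w].

Definition ord_first k : 'I_n := Ordinal (leq_ltn_trans (leq0n k) (ltn_ord k)).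
Definition ord_last k : 'I_n := rev_ord (ord_first k).

Definition uperm k : 'S_n :=
  [arg min_(w < tperm k (ord_first k) | w k == ord_first k) perm_len w].

Definition vperm k : 'S_n :=
  [arg min_(w < tperm k (ord_last k) | w k == ord_last k) perm_len w].

(* The product w0 v of permutations as functions, (w0 v)(j) = w0 (v j); the
   group law of 'S_n composes in the opposite order. *)
Definition w0vperm k : 'S_n := (vperm k * longest_perm)%g.

(* The transpose of MathComp's [perm_mx w]. *)
Definition dotmx (R : nzRingType) w : 'M[R]_n := \matrix_(i, j) (w j == i)%:R.

Definition hessenberg (h : 'I_n -> 'I_n) : Prop :=
  (forall i : 'I_n, (i <= h i)%N) /\
  (forall i j : 'I_n, j = i.+1 :> nat -> (h i <= h j)%N).

(* By the convention h(0) = 0 the first index is always a corner. *)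
Definition corners (h : 'I_n -> 'I_n) : set 'I_n :=
  [set i : 'I_n | forall j : 'I_n, i = j.+1 :> nat -> (h j < h i)%N].

End Permutations.

Section FlagVariety.
Variables (K : fieldType) (n : nat).

Definition GL : Type := {g : 'M[K]_n | g \in unitmx}.

(* A complete flag V_1 < ... < V_n; the subspace V_(i+1) is stored at i. *)
Definition is_flag (V : {ffun 'I_n -> {vspace 'cV[K]_n}}) : bool :=
  [forall i, \dim (V i) == i.+1] &&
  [forall i : 'I_n, forall j : 'I_n, (i <= j)%N ==> (V i <= V j)%VS].

Definition flag : Type := {V : {ffun 'I_n -> {vspace 'cV[K]_n}} | is_flag V}.

Definition lead_cols (R : Type) (A : 'M[R]_n) (i : 'I_n) : 'M[R]_(n, i.+1) :=
  colsub (widen_ord (ltn_ord i)) A.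

Definition col_flag (g : 'M[K]_n) : {ffun 'I_n -> {vspace 'cV[K]_n}} :=
  [ffun i : 'I_n => <<[seq col k (lead_cols g i) | k <- enum 'I_i.+1]>>%VS].

Lemma mem_col_flag (g : 'M[K]_n) (i : 'I_n) (v : 'cV[K]_n) :
  (v \in col_flag g i) = (v^T <= (lead_cols g i)^T)%MS.
Proof.
rewrite ffunE; apply/idP/submxP => [|[D /(congr1 trmx)]].
  set X := [seq _ | _ <- _] => vX.
  have -> : v = \sum_(k < i.+1)
      coord (in_tuple X) (cast_ord (esym (etrans (size_map _ _) (size_enum_ord _))) k) v
        *: col k (lead_cols g i).
    rewrite {1}(coord_span (X := in_tuple X) vX).
    set e := esym _.
    rewrite (reindex (cast_ord e)) /=; last first.
      by exists (cast_ord (esym e)) => k _; rewrite ?cast_ordK ?cast_ordKV.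
    apply: eq_bigr => k _; congr (_ *: _).
    by rewrite (nth_map k) ?size_enum_ord //= nth_ord_enum.
  exists (\row_k coord (in_tuple X)
      (cast_ord (esym (etrans (size_map _ _) (size_enum_ord _))) k) v).
  apply/rowP => j; rewrite !mxE summxE; apply: eq_bigr => k _.
  by rewrite !mxE.
rewrite trmxK trmx_mul trmxK => ->.
have -> : lead_cols g i *m D^T = \sum_k D 0 k *: col k (lead_cols g i).
  apply/colP => j; rewrite !mxE summxE; apply: eq_bigr => k _.
  by rewrite !mxE mulrC.
apply: memv_suml => k _; apply/memvZ/memv_span.
by apply: map_f; rewrite mem_enum.
Qed.

Lemma lead_cols_free (g : 'M[K]_n) (i : 'I_n) :
  g \in unitmx -> row_free (lead_cols g i)^T.
Proof.
move=> gU; apply/inj_row_free => v.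
rewrite /lead_cols trmx_mxsub => /(congr1 (mulmx^~ (invmx g^T))).
have -> : mxsub (widen_ord (ltn_ord i)) id g^T
        = rowsub (widen_ord (ltn_ord i)) 1%:M *m g^T by rewrite mul_rowsub_mx mul1mx.
rewrite mul0mx -!mulmxA mulmxV ?unitmx_tr // mulmx1.
move=> /rowP E; apply/rowP => k.
have := E (widen_ord (ltn_ord i) k).
rewrite !mxE (bigD1 k) //= !mxE eqxx mulr1 big1 ?addr0 // => l lk.
rewrite !mxE -val_eqE /=.
by move: lk; rewrite -val_eqE /= => /negPf->; rewrite mulr0.
Qed.

Lemma col_flagP (g : GL) : is_flag (col_flag (val g)).
Proof.
case: g => g /= gU; apply/andP; split.
  apply/forallP => i; rewrite ffunE.
  set X := [seq _ | _ <- _].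
  have sX : size X = i.+1 by rewrite size_map size_enum_ord.
  rewrite -[X in _ == X]sX; apply/(@freeP _ _ _ (in_tuple X)) => c.
  pose c' := \row_(k < i.+1) c (cast_ord (esym sX) k).
  move=> /= sum0; suff /rowP c0 : c' = 0.
    by move=> k; have := c0 (cast_ord sX k); rewrite !mxE cast_ordK.
  apply: (row_free_inj (lead_cols_free i gU)); rewrite mul0mx.
  apply/rowP => j; rewrite !mxE.
  have := congr1 (fun u : 'cV[K]_n => u j 0) sum0; rewrite summxE mxE => sum0j; rewrite -[RHS]sum0j.
  rewrite (reindex (cast_ord (esym sX))) /=; last first.
    by exists (cast_ord sX) => k _; rewrite ?cast_ordK ?cast_ordKV.
  apply: eq_bigr => k _; rewrite !mxE (nth_map k) ?size_enum_ord //=.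
  by rewrite nth_ord_enum !mxE; congr (c _ * _); apply: val_inj.
apply/forallP => i; apply/forallP => j; apply/implyP => ij.
rewrite !ffunE; apply/span_subvP => _ /mapP[k _ ->].
apply/memv_span/mapP; exists (widen_ord (ij : (i.+1 <= j.+1)%N) k).
  by rewrite mem_enum.
by apply/colP => r; rewrite !mxE; congr (g _ _); apply: val_inj.
Qed.

(* The projection G -> G/B. *)
Definition proj (g : GL) : flag := exist _ (col_flag (val g)) (col_flagP g).

Definition zpoly := {mpoly K[n * n]}.

Definition zmx : 'M[zpoly]_n := \matrix_(i, j) 'X_(mxvec_index i j).

Definition eval_at (f : zpoly) (g : 'M[K]_n) : K := f.@[mxvec g 0].

Definition vanish (I : set zpoly) (g : 'M[K]_n) : Prop :=
  forall f, I f -> eval_at f g = 0.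

(* The Zariski topology of G/B: it is the quotient topology for [proj], which
   is open, and the closed subsets of GL_n are cut out by polynomials in the
   matrix entries. *)
Definition closed_flags (F : set flag) : Prop :=
  exists P : set zpoly, forall g : GL, F (proj g) <-> vanish P (val g).

Definition flag_closure (A : set flag) : set flag :=
  [set V | forall F, closed_flags F -> A `<=` F -> F V].

Definition lower_tri (b : 'M[K]_n) : Prop := is_trig_mx b.
Definition upper_tri (b : 'M[K]_n) : Prop := is_trig_mx b^T.

(* In the next two definitions b is invertible because g is. *)
Definition schubert_cell (w : 'S_n) : set flag :=
  [set V | exists g : GL, exists b : 'M[K]_n,
     [/\ upper_tri b, val g = b *m dotmx K w & V = proj g]].

Definition opp_schubert_cell (w : 'S_n) : set flag :=
  [set V | exists g : GL, exists b : 'M[K]_n,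
     [/\ lower_tri b, val g = b *m dotmx K w & V = proj g]].

Definition schubert (w : 'S_n) : set flag := flag_closure (schubert_cell w).
Definition opp_schubert (w : 'S_n) : set flag := flag_closure (opp_schubert_cell w).

Definition richardson (u v : 'S_n) : set flag := opp_schubert u `&` schubert v.

End FlagVariety.

Section Ideals.
Variable R : comNzRingType.

Definition ideal_gen (A : set R) : set R :=
  [set p | exists m (a b : 'I_m -> R),
     (forall k, A (b k)) /\ p = \sum_k a k * b k].

Definition ideal_sum (T : finType) (I : T -> set R) : set R :=
  [set p | exists q : T -> R, (forall i, I i (q i)) /\ p = \sum_i q i].

Definition radical_ideal (I : set R) : Prop :=
  forall f m, I (f ^+ m) -> I f.

(* Row and column selections are arbitrary maps: one that is not injective
   gives 0 and reordering an injective one only changes the sign, so that the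
   ideal generated is that of the usual minors. *)
Definition minors (r m p : nat) (A : 'M[R]_(m, p)) : set R :=
  [set d | exists (f : 'I_r -> 'I_m) (g : 'I_r -> 'I_p), d = \det (mxsub f g A)].

End Ideals.

(* A closed subscheme Y of G/B is represented by an ideal I of C[z] such that
   the preimage of Y in GL_n is GL_n \cap Spec (C[z]/I).

   For w in S_n, u |-> dot w u B is an open immersion into G/B of the affine
   space of lower unitriangular matrices u, and these n! charts cover G/B. As
   the chart is the composite of u |-> dot w u with [proj], the part of Y in it
   is Spec of C[u]/J, where J is generated by the f(dot w u), f in I. Thus Y is
   reduced iff all the ideals J are radical. *)
Section Subschemes.
Variables (K : fieldType) (n : nat).

Definition below_diag : Type := {p : 'I_n * 'I_n | (p.2 < p.1)%N}.

Definition upoly := {mpoly K[#|{: below_diag}|]}.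

Definition umx : 'M[upoly]_n :=
  \matrix_(i, j) if insub (i, j) is Some p then 'X_(enum_rank (p : below_diag))
                 else (i == j)%:R.

Definition chart_mx (w : 'S_n) : 'M[upoly]_n := dotmx upoly w *m umx.

Definition chart_pullback (w : 'S_n) (f : zpoly K n) : upoly :=
  f \mPo [tuple mxvec (chart_mx w) 0 k | k < n * n].

Definition chart_ideal (I : set (zpoly K n)) (w : 'S_n) : set upoly :=
  ideal_gen [set chart_pullback w f | f in I].

Definition subscheme_reduced (I : set (zpoly K n)) : Prop :=
  forall w : 'S_n, radical_ideal (chart_ideal I w).

Definition subscheme_points (I : set (zpoly K n)) : set (flag K n) :=
  [set proj g | g in [set g : GL K n | vanish I (val g)]].

Definition hess_mx (R : nzRingType) (x z : 'M[R]_n) (h : 'I_n -> 'I_n) (i : 'I_n) :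
    'M[R]_(n, i.+1 + (h i).+1) :=
  row_mx (x *m lead_cols z i) (lead_cols z (h i)).

Definition hess_ideal_at (x : 'M[K]_n) (h : 'I_n -> 'I_n) (i : 'I_n) : set (zpoly K n) :=
  if ((h i).+1 < n)%N then
    ideal_gen (minors (h i).+2 (hess_mx (map_mx (@mpolyC _ K) x) (zmx K n) h i))
  else [set 0].

(* The Hessenberg scheme of x and h. *)
Definition hess_ideal (x : 'M[K]_n) (h : 'I_n -> 'I_n) : set (zpoly K n) :=
  ideal_sum (hess_ideal_at x h).

Definition hess_variety (x : 'M[K]_n) (h : 'I_n -> 'I_n) : set (flag K n) :=
  [set V : flag K n | forall (i : 'I_n) (v : 'cV[K]_n),
     v \in val V i -> x *m v \in val V (h i)].

Lemma rank_minors (r m p : nat) (A : 'M[K]_(m, p)) :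
  (forall d, minors r.+1 A d -> d = 0) <-> (\rank A <= r)%N.
Proof.
split=> [minors0 | rA d [f [g ->]]].
  rewrite leqNgt; apply/negP => rA.
  have [M [M_free [f MA]]] : exists M : 'M[K]_(r.+1, p),
      row_free M /\ exists f, M = rowsub f A.
    exists (rowsub (maxrankfun A \o widen_ord rA) A); split; last by eexists.
    rewrite rowsub_comp; apply/inj_row_free => v.
    have -> : rowsub (widen_ord rA) (rowsub (maxrankfun A) A) =
       rowsub (widen_ord rA) 1%:M *m rowsub (maxrankfun A) A.
      by rewrite mul_rowsub_mx mul1mx.
    rewrite mulmxA => /eqP; rewrite -(mul0mx _ (rowsub (maxrankfun A) A)).
    move=> /eqP /(row_free_inj (maxrowsub_free A)) /rowP E.
    apply/rowP => k; have := E (widen_ord rA k).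
    rewrite !mxE (bigD1 k) //= !mxE eqxx mulr1 big1 ?addr0 // => l lk.
    rewrite !mxE -val_eqE /=.
    by move: lk; rewrite -val_eqE /= => /negPf->; rewrite mulr0.
  have fullM : row_full M^T by rewrite /row_full mxrank_tr.
  have := mxrank_fullrowsub fullM; set g := fullrankfun _ => rg.
  have : \det (mxsub f g A) = 0 by apply: minors0; exists f, g.
  have -> : mxsub f g A = (rowsub g M^T)^T.
    by rewrite MA; apply/matrixP => i j; rewrite !mxE.
  rewrite det_tr => /eqP; apply/negP; rewrite -unitfE -unitmxE.
  by rewrite -row_full_unit /row_full rg.
apply/eqP; apply: contraTT rA; rewrite -unitfE -unitmxE => U.
rewrite -ltnNge -(mxrank_unit U).
have -> : mxsub f g A = rowsub f 1%:M *m A *m colsub g 1%:M.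
  by rewrite mul_rowsub_mx mul1mx mulmx_colsub mulmx1; apply/matrixP => i j; rewrite !mxE.
exact: leq_trans (mxrankM_maxl _ _) (mxrankM_maxr _ _).
Qed.

(* The scheme above has the flags V with x V_i <= V_h(i) as its points. *)
Lemma vanish_hess_ideal (x : 'M[K]_n) (h : 'I_n -> 'I_n) (g : GL K n) :
  vanish (hess_ideal x h) (val g) <->
  hess_variety x h (proj g).
Proof.
pose ev := meval (mxvec (val g) 0).
have evZ : map_mx ev (zmx K n) = val g.
  by apply/matrixP => i j; rewrite !mxE /ev mevalXU mxvecE.
have evx : map_mx ev (map_mx (@mpolyC _ K) x) = x.
  by apply/matrixP => i j; rewrite !mxE /ev mevalC.
have evM i : map_mx ev (hess_mx (map_mx (@mpolyC _ K) x) (zmx K n) h i)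
           = hess_mx x (val g) h i.
  by rewrite /hess_mx map_row_mx map_mxM evx /lead_cols !map_mxsub evZ.
have step i : (forall f, hess_ideal_at x h i f -> ev f = 0) <->
    (forall v, v \in col_flag (val g) i -> x *m v \in col_flag (val g) (h i)).
  have rkh : \rank (lead_cols (val g) (h i))^T = (h i).+1.
    exact/eqP/(lead_cols_free (h i) (valP g)).
  transitivity (\rank (hess_mx x (val g) h i) <= (h i).+1)%N.
    rewrite /hess_ideal_at; case: ltnP => hn; last first.
      split=> [_|_ f ->]; last exact: rmorph0.
      exact: leq_trans (rank_leq_row _) hn.
    rewrite -rank_minors; split=> [I0 d [r [c ->]] | M0 f [m [a [b [bM ->]]]]].
      rewrite -evM -map_mxsub det_map_mx; apply: I0.
      exists 1%N, (fun=> 1), (fun=> \det (mxsub r c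
        (hess_mx (map_mx (@mpolyC _ K) x) (zmx K n) h i))).
      by split=> [_|]; [exists r, c | rewrite big_ord1 mul1r].
    rewrite /ev rmorph_sum big1 // => k _; rewrite rmorphM /= -/ev.
    have [r [c ->]] := bM k.
    rewrite /ev -det_map_mx map_mxsub -[map_mx _ (hess_mx _ _ _ _)]/(map_mx ev _) evM.
    by rewrite (M0 (\det _)) ?mulr0 //; exists r, c.
  rewrite /hess_mx -mxrank_tr tr_row_mx -addsmxE.
  set A := (x *m _)^T; set B := (lead_cols _ _)^T in rkh *.
  have -> : (\rank (A + B)%MS <= (h i).+1)%N = (A <= B)%MS.
    apply/idP/idP => [le | AB].
      have := mxrank_leqif_sup (addsmxSr A B); rewrite rkh.
      move=> /geq_leqif; rewrite le => /esym sub.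
      exact: submx_trans (addsmxSl A B) sub.
    by rewrite -[X in (_ <= X)%N]rkh; apply: mxrankS; rewrite addsmx_sub AB submx_refl.
  split=> [AB v | xV].
    rewrite !mem_col_flag => vV; apply: submx_trans AB.
    by rewrite /A !trmx_mul; apply: submxMr.
  apply/row_subP => k.
  have := xV (row k (lead_cols (val g) i)^T)^T.
  rewrite !mem_col_flag trmxK row_sub => /(_ isT).
  by rewrite trmx_mul trmxK -row_mul -trmx_mul.
split=> [I0 i | xV f [q [qI ->]]].
  apply/(step i) => f If; apply: I0.
  exists (fun j => if j == i then f else 0); split; last first.
    rewrite (bigD1 i) //= eqxx big1 ?addr0 // => j /negPf->//.
  move=> j; case: eqP => [->//|_]; rewrite /hess_ideal_at; case: ifP => // _.
  by exists 0%N, (fun=> 0), (fun=> 0); split=> [[]//|]; rewrite big_ord0.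
rewrite /eval_at rmorph_sum big1 // => i _.
exact: (iffRL (step i) (xV i)).
Qed.
Definition diag_e1 : 'M[K]_n :=
  diag_mx (\row_j (j == 0 :> nat)%:R).

End Subschemes.

(* Main.v *)
(* As s = diag(1, 0, ..., 0) maps v to v_0 e_0, the minors defining the
   Hessenberg scheme at an invertible g generate the same ideal as the products
   x_i y_b with h(i) < b, where x is the first row of g and y the first column
   of g^-1.

   On the chart of w the matrix g is, up to a row permutation, a lower
   unitriangular matrix u of variables; x is row a and y column a of u and u^-1,
   where w(a) = 0. A triangular change of the variables in column a turns every
   y_b into plus or minus a variable, 0 or 1, so the ideal becomes a squarefree
   monomial ideal, which is radical.

   At a point all the products x_i y_b with h(i) < b vanish iff for some corner
   i the entries of x before i and those of y after h(i) vanish. These two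
   conditions define the opposite Schubert variety of u[i] and the Schubert
   variety of w0 v[h(i)]. They clearly hold on the cells; conversely a matrix
   satisfying the first one is joined to the permutation matrix by a line whose
   generic point lies in the cell, and g |-> g^-T w0 exchanges the two cases. *)
Require Import Defs.
From HB Require Import structures.
From mathcomp Require Import all_boot all_order all_fingroup all_algebra.
From mathcomp Require Import mpoly complex.
From mathcomp Require Import boolp classical_sets reals.
Set Implicit Arguments.
Unset Strict Implicit.
Unset Printing Implicit Defensive.
Import Order.TTheory GRing.Theory Num.Theory.
Local Open Scope ring_scope.
Local Open Scope classical_set_scope.

(** * Ideals generated by a set *)

Section IdealGen.
Variable R : comNzRingType.
Implicit Types (A B : set R) (x y : R).

Lemma mem_ideal_gen A x : A x -> ideal_gen A x.
Proof.
by move=> Ax; exists 1%N, (fun=> 1), (fun=> x); split=> //; rewrite big_ord1 mul1r.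
Qed.

Lemma ideal_gen0 A : ideal_gen A 0.
Proof. by exists 0%N, (fun=> 0), (fun=> 0); split=> [[]//|]; rewrite big_ord0. Qed.

Lemma ideal_genM A x y : ideal_gen A y -> ideal_gen A (x * y).
Proof.
move=> [m [a [b [Ab ->]]]]; exists m, (fun k => x * a k), b; split=> //.
by rewrite mulr_sumr; apply: eq_bigr => k _; rewrite mulrA.
Qed.

Lemma ideal_genMr A x y : ideal_gen A x -> ideal_gen A (x * y).
Proof. by rewrite mulrC; apply: ideal_genM. Qed.

Lemma ideal_genD A x y : ideal_gen A x -> ideal_gen A y -> ideal_gen A (x + y).
Proof.
move=> [m [a [b [Ab ->]]]] [p [c [d [Ad ->]]]].
pose glue (f : 'I_m -> R) (g : 'I_p -> R) k :=
  match split k with inl i => f i | inr i => g i end.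
exists (m + p)%N, (glue a c), (glue b d); split=> [k|].
  by rewrite /glue; case: (split k).
rewrite big_split_ord /glue; congr (_ + _); apply: eq_bigr => k _.
  by case: split_ordP => j /eqP; rewrite ?eq_lshift ?eq_lrshift // => /eqP->.
by case: split_ordP => j /eqP; rewrite ?eq_rshift ?eq_rlshift // => /eqP->.
Qed.

Lemma ideal_gen_sum A (I : Type) (r : seq I) (P : pred I) (F : I -> R) :
  (forall i, P i -> ideal_gen A (F i)) -> ideal_gen A (\sum_(i <- r | P i) F i).
Proof.
move=> AF; elim/big_rec: _ => [|i x Pi Ax]; first exact: ideal_gen0.
exact: ideal_genD (AF i Pi) Ax.
Qed.

Lemma ideal_gen_sub A B :
  A `<=` ideal_gen B -> ideal_gen A `<=` ideal_gen B.
Proof.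
by move=> AB _ [m [a [b [Ab ->]]]]; apply: ideal_gen_sum => k _; apply/ideal_genM/AB.
Qed.

Lemma det_ideal_gen_row A r (M : 'M[R]_r) (k : 'I_r) :
  (forall j, ideal_gen A (M k j)) -> ideal_gen A (\det M).
Proof.
by move=> AM; rewrite (expand_det_row M k); apply: ideal_gen_sum => j _;
  apply: ideal_genMr.
Qed.

End IdealGen.

Lemma ideal_gen_morph (R S : comNzRingType) (f : {rmorphism R -> S}) (A : set R) (B : set S) :
  (forall x, A x -> ideal_gen B (f x)) ->
  forall x, ideal_gen A x -> ideal_gen B (f x).
Proof.
move=> AB _ [m [a [b [Ab ->]]]]; rewrite rmorph_sum /=; apply: ideal_gen_sum => k _.
by rewrite rmorphM; apply/ideal_genM/AB.
Qed.

(** * Minors of a product of matrices *)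

Section Minors.
Variable R : comNzRingType.

(** Multilinearity in the rows, as for the Cauchy-Binet formula. The sum runs over all maps [s], not
    only increasing ones, which suits the arbitrary selections in [minors]. *)
Lemma det_mulmx_rows r m (A : 'M[R]_(r, m)) (B : 'M[R]_(m, r)) :
  \det (A *m B) =
  \sum_(s : {ffun 'I_r -> 'I_m}) (\prod_i A i (s i)) * \det (rowsub s B).
Proof.
transitivity (\sum_(p : 'S_r) \sum_(s : {ffun 'I_r -> 'I_m})
    (-1) ^+ p * \prod_i (A i (s i) * B (s i) (p i))).
  apply: eq_bigr => p _; rewrite -big_distrr /=; congr (_ * _).
  rewrite -(bigA_distr_bigA (fun i j => A i j * B j (p i))).
  by apply: eq_bigr => i _; rewrite mxE.
rewrite exchange_big; apply: eq_bigr => s _ /=.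
rewrite /determinant big_distrr; apply: eq_bigr => p _ /=.
rewrite big_split /= mulrCA; congr (_ * (_ * _)).
by apply: eq_bigr => i _; rewrite mxE.
Qed.

(** Left multiplication only forms linear combinations of rows. Used with [g] and with its inverse,
    this identifies the ideals of minors before and after reduction. *)
Lemma minors_mulmx r m p q (A : 'M[R]_(m, p)) (B : 'M[R]_(p, q)) :
  minors r (A *m B) `<=` ideal_gen (minors r B).
Proof.
move=> _ [f [g ->]].
have -> : mxsub f g (A *m B) = rowsub f A *m colsub g B.
  by apply/matrixP => i j; rewrite !mxE; apply: eq_bigr => k _; rewrite !mxE.
rewrite det_mulmx_rows; apply: ideal_gen_sum => s _; apply/ideal_genM/mem_ideal_gen.
by exists s, g; congr (\det _); apply/matrixP => i j; rewrite !mxE.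
Qed.

End Minors.

(** * Hessenberg minors against products of entries of [g] and its inverse *)

Section HessenbergMinors.
Variables (R : comUnitRingType) (n : nat) (h : 'I_n.+1 -> 'I_n.+1).
Variable g : 'M[R]_n.+1.

Definition hess_prods (i : 'I_n.+1) : set R :=
  [set d | exists j b : 'I_n.+1,
     [/\ (j <= i)%N, (h i < b)%N & d = g 0 j * invmx g b 0]].

Hypothesis gU : g \in unitmx.

(* [hess_mx] multiplied on the left by the inverse of [g]: the minors generate
   the same ideal, and the rows [b > h i] vanish outside the left block. *)
Let red (i : 'I_n.+1) : 'M[R]_(n.+1, i.+1 + (h i).+1) :=
  row_mx (\matrix_(b, j) (invmx g b 0 * g 0 (widen_ord (ltn_ord i) j)))
         (lead_cols 1%:M (h i)).

Let mul_red i : g *m red i = hess_mx (delta_mx 0 0) g h i.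
Proof.
rewrite /red /hess_mx mul_mx_row; congr row_mx; last first.
  by rewrite /lead_cols mulmx_colsub mulmx1.
have -> : (\matrix_(b, j) (invmx g b 0 * g 0 (widen_ord (ltn_ord i) j)))
        = invmx g *m (delta_mx 0 0 *m lead_cols g i).
  apply/matrixP => b j; rewrite !mxE (bigD1 0) //= big1 => [|k k0].
    rewrite addr0 !mxE (bigD1 0) //= big1 => [|k k0].
      by rewrite !mxE !eqxx mul1r addr0.
    by rewrite !mxE (negPf k0) andbF mul0r.
  rewrite !mxE big1 ?mulr0 // => l _.
  by rewrite !mxE (negPf k0) mul0r.
by rewrite mulKVmx.
Qed.

(** A minor of [red i] using only rows up to [h i] repeats a row, by the pigeonhole principle, and
    is zero. Any other one has a row [b > h i], whose entries are zero or products, and is expanded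
    along it. *)
Lemma minors_hess_mx i :
  minors (h i).+2 (hess_mx (delta_mx 0 0) g h i) `<=` ideal_gen (hess_prods i).
Proof.
rewrite -mul_red => d /minors_mulmx; apply: ideal_gen_sub => _ [s [c ->]].
have [/forallP hs|] := boolP [forall k, (s k <= h i)%N].
  have [s_inj|] := boolP (injectiveb s); last first.
    move=> /injectivePn[k [l kl skl]].
    rewrite (determinant_alternate kl) => [|j]; first exact: ideal_gen0.
    by rewrite !mxE skl.
  pose s' k : 'I_(h i).+1 := Ordinal (hs k : (s k < (h i).+1)%N).
  have /leq_card : injective s'.
    by move=> k l /(congr1 val)/= /val_inj; apply/injectiveP.
  by rewrite !card_ord ltnn.
rewrite negb_forall => /existsP[k]; rewrite -ltnNge => hk.
apply: (@det_ideal_gen_row _ _ _ _ k) => j; rewrite !mxE.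
case: splitP => l _; rewrite !mxE.
  apply: mem_ideal_gen; exists (widen_ord (ltn_ord i) l), (s k).
  by rewrite /= -ltnS ltn_ord mulrC.
have /negPf-> : s k != widen_ord (ltn_ord (h i)) l; last exact: ideal_gen0.
by rewrite -val_eqE /= gtn_eqF // (leq_trans _ hk) // ltnS -ltnS ltn_ord.
Qed.

Lemma hess_prods_minors i :
  hess_prods i `<=` ideal_gen (minors (h i).+2 (hess_mx (delta_mx 0 0) g h i)).
Proof.
move=> _ [j [b [ji hb ->]]].
have redE : red i = invmx g *m hess_mx (delta_mx 0 0) g h i.
  by rewrite -mul_red mulKmx.
have lt_hi : ((h i).+1 <= n.+1)%N by apply: ltn_ord.
(* The rows [b, 0, ..., h i] and the columns [j] of the left block, then the
   right block: the first row is zero after its first entry and the minor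
   complementary to that entry is an identity matrix. *)
pose r (k : 'I_(h i).+2) : 'I_n.+1 :=
  if unlift 0 k is Some k' then widen_ord lt_hi k' else b.
pose c (k : 'I_(h i).+2) : 'I_(i.+1 + (h i).+1) :=
  if unlift 0 k is Some k' then rshift _ k' else lshift _ (Ordinal (ji : (j < i.+1)%N)).
have rc0 : mxsub r c (red i) 0 0 = g 0 j * invmx g b 0.
  rewrite mxE /r /c unlift_none row_mxEl mxE mulrC.
  by congr (g _ _ * _); apply: val_inj.
have rcS k l : mxsub r c (red i) k (lift 0 l) = (r k == l :> nat)%:R.
  by rewrite mxE /c liftK row_mxEr !mxE.
have -> : g 0 j * invmx g b 0 = \det (mxsub r c (red i)).
  rewrite (expand_det_row _ 0) big_ord_recl big1 => [|k _].
    rewrite addr0 rc0 /cofactor addn0 expr0 mul1r.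
    suff -> : row' 0 (col' 0 (mxsub r c (red i))) = 1%:M by rewrite det1 mulr1.
    by apply/matrixP => k l; rewrite 2!mxE rcS /r liftK mxE.
  rewrite rcS /r unlift_none gtn_eqF ?mul0r //.
  by rewrite (leq_trans _ hb) // ltnS -ltnS ltn_ord.
by apply: (@minors_mulmx _ _ _ _ _ (invmx g)); rewrite -redE; exists r, c.
Qed.

End HessenbergMinors.

(** * Squarefree monomial ideals are radical *)

Section SquarefreeMonomials.
Variables (K : idomainType) (N : nat).
Implicit Types (S T : {set 'I_N}) (q : 'X_{1..N}) (f : {mpoly K[N]}).

Definition squarefree T : {mpoly K[N]} := \prod_(k in T) 'X_k.

Definition mnm_supp q : {set 'I_N} := [set k | q k != 0%N]%SET.

Let kill S : N.-tuple {mpoly K[N]} := [tuple if k \in S then 'X_k else 0 | k < N].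

Lemma kill_squarefree S T :
  ~~ (T \subset S) -> squarefree T \mPo kill S = 0.
Proof.
move=> /subsetPn[k kT kS]; rewrite /squarefree rmorph_prod (bigD1 k) //=.
by rewrite comp_mpolyXU -tnth_nth tnth_mktuple (negPf kS) mul0r.
Qed.

Lemma killX S q :
  'X_[q] \mPo kill S = if mnm_supp q \subset S then 'X_[q] else 0 :> {mpoly K[N]}.
Proof.
rewrite comp_mpolyX; case: ifPn => [/fintype.subsetP qS | /subsetPn[k]].
  rewrite [RHS]mpolyXE_id; apply: eq_bigr => k _; rewrite tnth_mktuple.
  have [-> //|qk] := eqVneq (q k) 0%N.
  by rewrite qS // inE.
rewrite inE => qk kS; rewrite (bigD1 k) //= tnth_mktuple (negPf kS).
by rewrite expr0n (negPf qk) mul0r.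
Qed.

Lemma mcoeff_kill S q f : mnm_supp q \subset S -> (f \mPo kill S)@_q = f@_q.
Proof.
move=> qS; rewrite [X in (X \mPo _)@_q]mpolyE [RHS](congr1 (mcoeff q) (mpolyE f)).
rewrite (raddf_sum (comp_mpoly (kill S))) !raddf_sum /=.
apply: eq_bigr => m _; rewrite comp_mpolyZ killX.
case: ifPn => // mS; rewrite !mcoeffZ mcoeff0 mcoeffX.
by case: eqP => [mq | _]; rewrite ?mulr0 //; move: mS; rewrite mq qS.
Qed.

Lemma squarefree_dvd T q : T \subset mnm_supp q ->
  exists m, 'X_[q] = 'X_[m] * squarefree T :> {mpoly K[N]}.
Proof.
move=> /fintype.subsetP Tq; pose m := [multinom (q k - (k \in T))%N | k < N].
exists m; rewrite 2!mpolyXE_id /squarefree [X in _ * X]big_mkcond /=.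
rewrite -big_split; apply: eq_bigr => k _; rewrite mnmE /=.
case: (boolP (k \in T)) => kT; last by rewrite subn0 mulr1.
by rewrite -exprSr subn1 prednK // lt0n; have := Tq k kT; rewrite inE.
Qed.

(* If no generator divides a monomial [q] of [f], then setting to zero the
   variables outside [q] kills the ideal but not [f]. *)
Lemma squarefree_radical (G : set {set 'I_N}) :
  radical_ideal (ideal_gen [set squarefree T | T in G]).
Proof.
move=> f m Jfm; rewrite [f]mpolyE big_seq; apply: ideal_gen_sum => q qf.
rewrite -mul_mpolyC; apply: ideal_genM.
have [[T [GT Tq]] | noT] := pselect (exists T, G T /\ T \subset mnm_supp q).
  have [p ->] := squarefree_dvd Tq.
  by apply/ideal_genM/mem_ideal_gen; exists T.
have kill0 : f ^+ m \mPo kill (mnm_supp q) = 0.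
  have [p [a [b [Gb ->]]]] := Jfm; rewrite rmorph_sum big1 // => k _.
  rewrite rmorphM /=; have [T GT <-] := Gb k.
  rewrite kill_squarefree ?mulr0 //; apply/negP => Tq.
  by apply: noT; exists T.
have := mcoeff_kill f (fintype.subxx (mnm_supp q)).
move: kill0; rewrite rmorphXn /= => /eqP; rewrite expf_eq0 => /andP[_ /eqP->].
by rewrite mcoeff0 => /esym/eqP; rewrite mcoeff_eq0 qf.
Qed.

End SquarefreeMonomials.

(** * Inverses of triangular matrices *)

Section TriangularInverse.
Variables (R : comUnitRingType) (n : nat).
Implicit Types (A : 'M[R]_n).

Lemma unitmx_trig_diag A (i : 'I_n) :
  is_trig_mx A -> A \in unitmx -> A i i \is a GRing.unit.
Proof.
by move=> At; rewrite unitmxE (det_trig At) (bigD1 i) //= unitrM => /andP[].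
Qed.

(** Forward substitution: equation [i] involves only the rows of [z] up to [i], and its diagonal
    coefficient is a unit. *)
Lemma trig_solve A m (z : 'M[R]_(n, m)) (a : nat) :
  is_trig_mx A -> A \in unitmx ->
  (forall (i : 'I_n) j, (i < a)%N -> (A *m z) i j = 0) ->
  forall (i : 'I_n) j, (i < a)%N -> z i j = 0.
Proof.
move=> At AU Az i j; have [k] := ubnP (val i).
elim: k i => // k IHk i ik ia.
have := Az i j ia; rewrite mxE (bigD1 i) //=.
rewrite big1 ?addr0 => [/(canRL (mulKr (unitmx_trig_diag i At AU))) | l li].
  by rewrite mulr0.
have [il | il] := ltnP i l; first by have /is_trig_mxP-> := At; rewrite ?mul0r.
have li' : (l < i)%N by rewrite ltn_neqAle il andbT; exact: li.
by rewrite IHk ?mulr0 //; [exact: leq_trans li' ik | exact: ltn_trans li' ia].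
Qed.

Lemma trig_invmx A : is_trig_mx A -> A \in unitmx -> is_trig_mx (invmx A).
Proof.
move=> At AU; apply/is_trig_mxP => i j ij.
(* Column [j] of the inverse is turned into a one-column matrix, to which [trig_solve] applies with
   bound [j]. *)
rewrite -[LHS](mxE matrix_key (fun i _ => invmx A i j) i (0 : 'I_1)).
apply: (trig_solve (a := j) At AU) => // k l kj.
rewrite mxE (eq_bigr (fun m => A k m * invmx A m j)) => [|m _]; last by rewrite mxE.
transitivity ((A *m invmx A) k j); first by rewrite mxE.
by rewrite (mulmxV AU) mxE -val_eqE ltn_eqF.
Qed.

End TriangularInverse.

(** * Lower unitriangular matrices *)

Section LowerUnitriangular.
Variables (R : comNzRingType) (n : nat).
Implicit Types (A : 'M[R]_n).

Definition lower_uni A : Prop :=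
  forall i j : 'I_n, (i <= j)%N -> A i j = (i == j)%:R.

Lemma lower_uni_trig A : lower_uni A -> is_trig_mx A.
Proof.
by move=> Au; apply/is_trig_mxP => i j ij; rewrite Au 1?ltnW // -val_eqE ltn_eqF.
Qed.

Lemma det_lower_uni A : lower_uni A -> \det A = 1.
Proof.
move=> Au; rewrite (det_trig (lower_uni_trig Au)).
by rewrite big1 // => i _; rewrite Au ?eqxx.
Qed.

End LowerUnitriangular.

(** * Coordinates of a chart and substitutions in them *)

Section Chart.
Variables (K : fieldType) (n' : nat).
Let n := n'.+1.
Local Notation upoly := (upoly K n).
Local Notation umx := (umx K n).
Implicit Types (a i j b : 'I_n) (w : 'S_n).

Lemma umx_lower : lower_uni umx.
Proof. by move=> i j ij; rewrite mxE insubN //= -leqNgt. Qed.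

Lemma umx_unit : umx \in unitmx.
Proof. by rewrite unitmxE (det_lower_uni umx_lower) unitr1. Qed.

(** A set rather than an index, so that it is empty on the diagonal, where its monomial is 1, the
    diagonal entry of [umx]. *)
Definition entry_var (i j : 'I_n) : {set 'I_#|{: below_diag n}|} :=
  [set k | val (enum_val k) == (i, j)]%SET.

Lemma squarefree_entry_var i j : (j <= i)%N ->
  squarefree K (entry_var i j) = umx i j.
Proof.
move=> ji; rewrite mxE /squarefree; case: insubP => [p _ pE | ].
  rewrite (big_pred1 (enum_rank p)) // => k; rewrite !inE -pE val_eqE -(inj_eq enum_val_inj).
  by rewrite enum_rankK.
rewrite /= -leqNgt => ij; have -> : i = j by apply/val_inj/anti_leq/andP.
rewrite eqxx big_pred0 // => k; rewrite inE; apply/negP => /eqP ek.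
by have := valP (enum_val k); rewrite ek /= ltnn.
Qed.

Definition usubst_tuple (M : 'M[upoly]_n) :=
  [tuple M (val (enum_val k)).1 (val (enum_val k)).2 | k < #|{: below_diag n}|].

Definition usubst (M : 'M[upoly]_n) : {rmorphism upoly -> upoly} :=
  comp_mpoly (usubst_tuple M).

Lemma usubstX M k :
  usubst M 'X_k = M (val (enum_val k)).1 (val (enum_val k)).2.
Proof. by rewrite [LHS]comp_mpolyXU -tnth_nth tnth_mktuple. Qed.

Lemma map_usubst M : lower_uni M -> map_mx (usubst M) umx = M.
Proof.
move=> Mu; apply/matrixP => i j; rewrite !mxE.
case: insubP => [p _ pE | ]; last first.
  by rewrite /= -leqNgt => ij; rewrite Mu // rmorph_nat.
by rewrite usubstX enum_rankK pE.
Qed.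

Lemma usubst_id f : usubst umx f = f.
Proof.
rewrite -[RHS]comp_mpoly_id; congr (_ \mPo _).
apply: eq_from_tnth => k; rewrite !tnth_mktuple mxE.
case: insubP => [p _ pE | ]; last by case: (enum_val k) => p /= ->.
by move: pE; rewrite -surjective_pairing => /val_inj->; rewrite enum_valK.
Qed.

Lemma usubst_comp M N f : usubst M (usubst N f) = usubst (map_mx (usubst M) N) f.
Proof.
transitivity (usubst M (\sum_(m <- msupp f) f@_m *: ('X_[m] \mPo usubst_tuple N))).
  congr (usubst M _); rewrite [in LHS](mpolyE f) raddf_sum /=.
  by apply: eq_bigr => m _; rewrite comp_mpolyZ.
rewrite [in RHS](mpolyE f) !raddf_sum /=; apply: eq_bigr => m _.
rewrite !comp_mpolyZ; congr (_ *: _).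
rewrite !comp_mpolyX rmorph_prod /=; apply: eq_bigr => k _.
by rewrite rmorphXn /= !tnth_mktuple mxE.
Qed.

End Chart.

(** * The triangular change of variables in column [a] *)

Section ColumnChange.
Variables (K : fieldType) (n' : nat).
Let n := n'.+1.
Local Notation upoly := (upoly K n).
Local Notation umx := (umx K n).
Variable a : 'I_n.

Definition replace_col (z : 'cV[upoly]_n) : 'M[upoly]_n :=
  \matrix_(i, j) if j == a then z i 0 else umx i j.

Let e : 'cV[upoly]_n := delta_mx a 0.
Let c : 'cV[upoly]_n := col a umx.
Let u0 : 'M[upoly]_n := replace_col e.

Lemma replace_col_lower (z : 'cV[upoly]_n) :
  (forall i : 'I_n, (i <= a)%N -> z i 0 = (i == a)%:R) -> lower_uni (replace_col z).
Proof.
move=> za i j ij; rewrite mxE; case: eqP => [ja | _]; last exact: umx_lower.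
by rewrite za -?ja.
Qed.

Lemma replace_colE z : replace_col z = u0 + (z - e) *m (delta_mx 0 a).
Proof.
apply/matrixP => i j; rewrite !mxE big_ord1 !mxE /=.
by case: eqP => _; rewrite ?mulr0 ?addr0 // mulr1 subrKC.
Qed.

Lemma mul_u0_e : u0 *m e = e.
Proof.
apply/colP => i; rewrite mxE (bigD1 a) //= big1 ?addr0 => [|j ja]; rewrite !mxE.
  by rewrite !eqxx mulr1.
by rewrite (negPf ja) mulr0.
Qed.

Lemma u0_lower : lower_uni u0.
Proof. by apply: replace_col_lower => i _; rewrite mxE andbT. Qed.

Lemma u0_unit : u0 \in unitmx.
Proof. by rewrite unitmxE (det_lower_uni u0_lower) unitr1. Qed.

(* With [c] column [a] of the unitriangular matrix [u] and [u0] the matrix [u]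
   with that column replaced by [e], the substitution [c |-> u0 c] fixes [u0] and
   maps column [a] of the inverse of [u] to [2 e - c]. *)
Definition shear_col : 'M[upoly]_n := replace_col (u0 *m c).
Definition unshear_col : 'M[upoly]_n := replace_col (invmx u0 *m c).

Let ce0 (i : 'I_n) j : (i < a.+1)%N -> (c - e) i j = 0.
Proof.
rewrite ltnS => ia; rewrite !mxE (ord1 j) eqxx andbT.
by have := umx_lower K ia; rewrite mxE => ->; rewrite subrr.
Qed.

Lemma shear_col_lower : lower_uni shear_col.
Proof.
apply: replace_col_lower => i ia.
(* [u0] fixes [e], while [c - e] vanishes in the rows up to [a], which a lower triangular matrix
   preserves. *)
have -> : u0 *m c = u0 *m (c - e) + e by rewrite mulmxBr mul_u0_e subrK.
rewrite mxE [e _ _]mxE andbT mxE big1 ?add0r // => j _.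
have [ja | aj] := leqP j a; first by rewrite ce0 ?mulr0.
have ij := leq_ltn_trans ia aj.
by rewrite u0_lower 1?ltnW // -val_eqE /= ltn_eqF ?mul0r.
Qed.

Lemma unshear_col_lower : lower_uni unshear_col.
Proof.
apply: replace_col_lower => i ia.
have -> : invmx u0 *m c = invmx u0 *m (c - e) + e.
  by rewrite mulmxBr -[X in _ - invmx _ *m X]mul_u0_e (mulKmx u0_unit) subrK.
rewrite mxE [e _ _]mxE andbT.
rewrite (trig_solve (lower_uni_trig u0_lower) u0_unit (a := a.+1)) ?add0r // => k j ka.
by rewrite (mulKVmx u0_unit) ce0.
Qed.

(** The substitution changes only the variables of column [a], and none of these occurs in [u0]. *)
Lemma unshear_u0 : map_mx (usubst unshear_col) u0 = u0.
Proof.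
have := map_usubst unshear_col_lower => /matrixP E.
apply/matrixP => i j; have := E i j; rewrite mxE => Eij.
rewrite !mxE; case: eqP => [ja | /eqP/negPf ja]; first by rewrite rmorph_nat.
by have := Eij; rewrite !mxE ja => ->.
Qed.

(** As [u0] is fixed, [u0 c] is sent to [u0 (u0^-1 c) = c]. *)
Lemma usubst_shearK f : usubst unshear_col (usubst shear_col f) = f.
Proof.
rewrite usubst_comp -[RHS]usubst_id; congr (usubst _ f).
have /matrixP E := map_usubst unshear_col_lower.
have c_im : map_mx (usubst unshear_col) c = invmx u0 *m c.
  rewrite map_col map_usubst; last exact: unshear_col_lower.
  by apply/colP => i; rewrite !mxE eqxx.
apply/matrixP => i j; rewrite mxE [shear_col _ _]mxE.
case: eqP => [-> | /eqP/negPf ja].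
  have -> : umx i a = (u0 *m (invmx u0 *m c)) i 0 by rewrite (mulKVmx u0_unit) [RHS]mxE.
  by rewrite -c_im -unshear_u0 -map_mxM [RHS]mxE unshear_u0.
by have := E i j; rewrite mxE => ->; rewrite mxE ja.
Qed.

(** The image of [umx] is the rank one modification of [u0] by [u0 c - e] in column [a]. Entry [a]
    of [2 e - c] is 1, so this image sends [2 e - c] to [(2 e - u0 c) + (u0 c - e) = e]. *)
Lemma usubst_shear_inv :
  map_mx (usubst shear_col) (col a (invmx umx)) = (e + e) - c.
Proof.
have shU : shear_col \in unitmx.
  by rewrite unitmxE (det_lower_uni shear_col_lower) unitr1.
apply: (can_inj (mulKmx shU)).
have -> : shear_col *m ((e + e) - c) = e.
  have -> : shear_col *m ((e + e) - c) =
     u0 *m ((e + e) - c) + (u0 *m c - e) *m (delta_mx 0 a *m ((e + e) - c)).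
    by rewrite /shear_col replace_colE [LHS]mulmxDl mulmxA.
  have -> : delta_mx 0 a *m ((e + e) - c) = 1%:M :> 'M_1.
    rewrite -rowE; apply/matrixP => i j; rewrite !ord1 !mxE !eqxx.
    have := umx_lower K (leqnn a); rewrite mxE eqxx => ->.
    by rewrite andbT addrK.
  by rewrite mulmx1 mulmxBr mulmxDr mul_u0_e addrA subrK addrK.
rewrite -[X in X *m _](map_usubst shear_col_lower) -map_mxM.
have -> : umx *m col a (invmx umx) = e.
  by rewrite colE mulmxA (mulmxV (umx_unit K n')) mul1mx.
by apply/colP => i; rewrite !mxE rmorph_nat.
Qed.

Let prod_sf i b : {set 'I_#|{: below_diag n}|} :=
  (entry_var a i :|: entry_var b a)%SET.

Lemma squarefree_prod_sf (i b : 'I_n) : (i <= a)%N -> (a <= b)%N -> (i < b)%N ->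
  squarefree K (prod_sf i b) = umx a i * umx b a.
Proof.
move=> ia ab ib; rewrite /squarefree (eq_bigl (mem [predU entry_var a i & entry_var b a])) => [|k].
  rewrite bigU /=; last first.
    (* The two positions [(a, i)] and [(b, a)] could coincide only for [i = a = b], against
       [i < b]. *)
    apply/pred0P => k /=; rewrite !inE; apply/negP => /andP[/eqP-> /eqP[ba]].
    by move=> ia'; move: ib; rewrite -ba ia' ltnn.
  by rewrite -!squarefree_entry_var.
by rewrite !inE.
Qed.

(** Outside [i <= a <= b] one factor vanishes by triangularity. Inside, the entry [(a, i)] is left
    unchanged, and the other factor is [2 - 1 = 1] for [b = a] and minus a variable for [b > a],
    whence the sign. *)
Lemma usubst_shear_prod (i b : 'I_n) : (i < b)%N ->
  usubst shear_col (umx a i * invmx umx b a) =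
  if (i <= a <= b)%N then (-1) ^+ (a < b)%N * squarefree K (prod_sf i b) else 0.
Proof.
move=> ib; rewrite rmorphM.
have -> : usubst shear_col (umx a i) = shear_col a i.
  by rewrite -[in RHS](map_usubst shear_col_lower) [RHS]mxE.
have -> : usubst shear_col (invmx umx b a) = (b == a)%:R *+ 2 - umx b a.
  have /colP/(_ b) := usubst_shear_inv; rewrite mxE [col _ _ _ _]mxE => ->.
  by rewrite mxE [(e + e) _ _]mxE [(- c) _ _]mxE !mxE andbT mulr2n.
have [ia | ai] /= := leqP i a; last first.
  by rewrite shear_col_lower 1?ltnW // -val_eqE ltn_eqF ?mul0r.
have -> : shear_col a i = umx a i.
  have [-> | ne] := eqVneq i a.
    by rewrite shear_col_lower // umx_lower.
  by rewrite mxE (negPf ne).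
have [ab | ba] /= := leqP a b; last first.
  by rewrite (umx_lower K (ltnW ba)) -val_eqE ltn_eqF //= mul0rn subrr mulr0.
rewrite squarefree_prod_sf // mulrCA; congr (_ * _).
have [ab' | ba] := ltnP a b.
  by rewrite -val_eqE gtn_eqF //= mul0rn sub0r expr1 mulN1r.
have -> : b = a by apply/val_inj/anti_leq; rewrite ba ab.
by rewrite eqxx umx_lower // eqxx expr0 mul1r mulr2n addrK.
Qed.

Variable h : 'I_n -> 'I_n.

Definition chart_prods : set upoly :=
  [set d | exists i b : 'I_n, (h i < b)%N /\ d = umx a i * invmx umx b a].

(** The shear carries the ideal into a squarefree monomial one, whose radicality applies to the
    image of [f]. The inverse substitution brings the conclusion back. *)
Lemma chart_prods_radical (J : set upoly) : (forall i : 'I_n, (i <= h i)%N) ->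
  J `<=` ideal_gen chart_prods -> ideal_gen chart_prods `<=` J -> radical_ideal J.
Proof.
move=> h_ge Jp pJ f m /Jp Jfm; apply: pJ.
pose G := [set T | exists i b : 'I_n, [/\ (h i < b)%N, (i <= a <= b)%N & T = prod_sf i b]].
have Gf : ideal_gen [set squarefree K T | T in G] (usubst shear_col f).
  apply: (squarefree_radical (m := m)); rewrite -rmorphXn /=.
  apply: ideal_gen_morph Jfm => _ [i [b [hb ->]]].
  rewrite usubst_shear_prod ?(leq_ltn_trans (h_ge i)) //.
  case: ifP => iab; last exact: ideal_gen0.
  by apply/ideal_genM/mem_ideal_gen; exists (prod_sf i b) => //; exists i, b.
rewrite -[f]usubst_shearK; apply: ideal_gen_morph Gf => _ [T [i [b [hb iab ->]]] <-].
have := usubst_shear_prod (leq_ltn_trans (h_ge i) hb); rewrite iab => E.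
have -> : squarefree K (prod_sf i b) =
    usubst shear_col ((-1) ^+ (a < b)%N * (umx a i * invmx umx b a)).
  by rewrite rmorphM rmorph_sign E mulrA -signr_addb addbb mul1r.
by rewrite usubst_shearK; apply/ideal_genM/mem_ideal_gen; exists i, b.
Qed.

End ColumnChange.

(** * Hessenberg functions and the Hessenberg ideal on each chart *)

Lemma hessenberg_mono n (h : 'I_n -> 'I_n) : hessenberg h ->
  forall i j : 'I_n, (i <= j)%N -> (h i <= h j)%N.
Proof.
move=> [_ h_mono] i j; have [k] := ubnP (j - i); elim: k j => // k IHk j jik ij.
have [->//|ne] := eqVneq i j.
have lt_ij : (i < j)%N by rewrite ltn_neqAle ij andbT; exact: ne.
have j1 : (j.-1 < n)%N by rewrite (leq_ltn_trans (leq_pred j)).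
have jK : j.-1.+1 = j by rewrite prednK // (leq_ltn_trans _ lt_ij).
have ij1 : (i <= j.-1)%N by rewrite -ltnS jK.
apply: leq_trans (h_mono (Ordinal j1) j (esym jK)); apply: IHk => //=.
by rewrite -ltnS -subSn // jK.
Qed.

Section HessenbergCharts.
Variables (K : fieldType) (n' : nat).
Let n := n'.+1.
Variables (w : 'S_n) (h : 'I_n -> 'I_n).
Local Notation zpoly := (zpoly K n).
Local Notation upoly := (upoly K n).
Local Notation chart := (chart_mx K w).
Local Notation hess_ideal := (hess_ideal (diag_e1 K n) h).

Lemma diag_e1E (R : fieldType) : diag_e1 R n = delta_mx 0 0.
Proof.
apply/matrixP => i j; rewrite !mxE.
have [<- | ij] := eqVneq i j; first by rewrite andbb mulr1n.
by case: (eqVneq i 0) ij => [-> /negPf | ]; rewrite ?mulr0n //= eq_sym => ->.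
Qed.

Lemma dotmx_perm (R : nzRingType) (s : 'S_n) : Defs.dotmx R s = perm_mx s^-1.
Proof. by apply/matrixP => i j; rewrite !mxE -[in RHS](inj_eq (@perm_inj _ s)) permKV eq_sym. Qed.

Lemma chart_mx_unit : chart \in unitmx.
Proof. by rewrite /chart_mx dotmx_perm unitmx_mul unitmx_perm umx_unit. Qed.

Lemma chart_mxE i j : chart i j = umx K n ((w^-1)%g i) j.
Proof.
rewrite /chart_mx dotmx_perm -row_permE mxE.
by [].
Qed.

Lemma invmx_chart_mxE i j : invmx chart i j = invmx (umx K n) i ((w^-1)%g j).
Proof.
have <- : invmx chart *m Defs.dotmx _ w = invmx (umx K n).
  apply: (can_inj (mulmxK (umx_unit K n'))).
  by rewrite -mulmxA (mulVmx chart_mx_unit) (mulVmx (umx_unit K n')).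
rewrite mxE (bigD1 j) //= big1 ?addr0 => [|k kj]; rewrite mxE permKV.
  by rewrite eqxx mulr1.
by rewrite eq_sym (negPf kj) mulr0.
Qed.

Let pullback : {rmorphism zpoly -> upoly} :=
  comp_mpoly [tuple mxvec chart 0 k | k < n * n].

Lemma pullback_hess_mx i :
  map_mx pullback (hess_mx (map_mx (@mpolyC _ K) (diag_e1 K n)) (zmx K n) h i) =
  hess_mx (delta_mx 0 0) chart h i.
Proof.
have pz : map_mx pullback (zmx K n) = chart.
  apply/matrixP => k l; rewrite !mxE [LHS]comp_mpolyXU -tnth_nth tnth_mktuple.
  by rewrite mxvecE mxE.
have pe : map_mx pullback (map_mx (@mpolyC _ K) (diag_e1 K n)) = delta_mx 0 0.
  rewrite diag_e1E; apply/matrixP => k l; rewrite !mxE [LHS]comp_mpolyC.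
  exact: rmorph_nat.
by rewrite /hess_mx map_row_mx map_mxM pe /lead_cols !map_mxsub pz.
Qed.

(** The first row of the chart matrix is row [w^-1 0] of [umx], and the first column of its inverse
    is column [w^-1 0] of the inverse of [umx]; hence this value of [a]. *)
Lemma chart_hess_idealP : hessenberg h ->
  chart_ideal hess_ideal w `<=` ideal_gen (@chart_prods K n' ((w^-1)%g 0) h).
Proof.
move=> [h_ge h_mono]; apply: ideal_gen_sub => _ [f [q [qI ->]] <-].
rewrite -[chart_pullback _ _]/(pullback _) rmorph_sum; apply: ideal_gen_sum => i _.
have := qI i; rewrite /hess_ideal_at; case: ifP => _ q_i; last first.
  by rewrite q_i rmorph0; apply: ideal_gen0.
apply: ideal_gen_morph q_i => _ [r [c ->]].
rewrite -det_map_mx map_mxsub pullback_hess_mx.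
have : minors (h i).+2 (hess_mx (delta_mx 0 0) chart h i)
         (\det (mxsub r c (hess_mx (delta_mx 0 0) chart h i))) by exists r, c.
move=> /(minors_hess_mx chart_mx_unit); apply: ideal_gen_sub => _ [j [b [ji hb ->]]].
apply: mem_ideal_gen; exists j, b; rewrite chart_mxE invmx_chart_mxE; split=> //.
(* A product from index [i] has [j <= i], and monotonicity of [h] turns [h i < b] into [h j < b]. *)
by apply: leq_ltn_trans hb; apply: hessenberg_mono.
Qed.

Lemma chart_prods_hess :
  ideal_gen (@chart_prods K n' ((w^-1)%g 0) h) `<=` chart_ideal hess_ideal w.
Proof.
apply: ideal_gen_sub => _ [i [b [hb ->]]].
have : hess_prods h chart i (chart 0 i * invmx chart b 0) by exists i, b.
rewrite chart_mxE invmx_chart_mxE => /(hess_prods_minors chart_mx_unit).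
apply: ideal_gen_sub => _ [r [c ->]]; apply: mem_ideal_gen.
exists (\det (mxsub r c
  (hess_mx (map_mx (@mpolyC _ K) (diag_e1 K n)) (zmx K n) h i))); last first.
  by rewrite -[chart_pullback _ _]/(pullback _) -det_map_mx map_mxsub pullback_hess_mx.
pose q j : zpoly := if j == i then \det (mxsub r c
  (hess_mx (map_mx (@mpolyC _ K) (diag_e1 K n)) (zmx K n) h i)) else 0.
exists q; split=> [j|]; last first.
  by rewrite (bigD1 i) //= /q eqxx big1 ?addr0 // => j /negPf->.
rewrite /hess_ideal_at /q; have [-> | _] := eqVneq j i.
  (* The existence of [b > h i] selects the branch of the ideal generated by minors. *)
  rewrite (leq_ltn_trans hb) //; apply: mem_ideal_gen.
  by exists r, c.
by case: ifP => // _; apply: ideal_gen0.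
Qed.

Lemma chart_hess_radical : hessenberg h -> radical_ideal (chart_ideal hess_ideal w).
Proof.
move=> hh; apply: (chart_prods_radical (a := (w^-1)%g 0) (h := h) hh.1).
  exact: chart_hess_idealP.
exact: chart_prods_hess.
Qed.

End HessenbergCharts.

(** * Inversions of the shortest and longest permutations *)

Section ShortestPermutations.
Variable n' : nat.
Let n := n'.+1.
Implicit Types (w u : 'S_n) (i j k : 'I_n).

Definition inversions w : {set 'I_n * 'I_n} :=
  [set p : 'I_n * 'I_n | (p.1 < p.2)%N && (w p.2 < w p.1)%N]%SET.

(** For [w] of minimal length under a constraint, [A] is the set of inversions that the constraint
    forces, and [w'] is a competitor without any others. *)
Lemma inversions_min w w' (A : {set 'I_n * 'I_n}) :
  A \subset inversions w -> inversions w' \subset A -> (perm_len w <= perm_len w')%N ->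
  inversions w = A.
Proof.
move=> Aw w'A ww'; apply/esym/eqP; rewrite eqEcard Aw.
exact: leq_trans ww' (subset_leq_card w'A).
Qed.

(** This is all that the geometry needs from minimality. After reversal of the positions it covers
    [w0vperm] as well. *)
Definition short_first u k : Prop :=
  u k = 0 /\ forall i j, (i < j)%N -> (u j < u i)%N -> j = k.

Lemma uperm_short k : short_first (uperm k) k.
Proof.
have first0 : ord_first k = 0 by apply: val_inj.
rewrite /uperm; case: arg_minnP => [|u /eqP uk u_min]; first by rewrite tpermL.
rewrite first0 in uk u_min; split=> // i j ij uji.
(* This competitor sends [k] to 0 and is increasing elsewhere, so all its inversions end at [k]. *)
pose w := lift_perm k 0 1 : 'S_n.
pose A := [set p : 'I_n * 'I_n | (p.1 < p.2)%N && (p.2 == k)]%SET.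
suff : (i, j) \in A by rewrite inE => /andP[_ /eqP].
rewrite -(@inversions_min u w A) ?inE /= ?ij //.
- apply/fintype.subsetP => -[x y]; rewrite !inE /= => /andP[xy /eqP yk].
  rewrite xy yk uk lt0n; apply/negP => /eqP ux0.
  have : u x = u k by apply: val_inj; rewrite uk.
  by move/perm_inj => xk; move: xy; rewrite yk xk ltnn.
- apply/fintype.subsetP => -[x y]; rewrite !inE /= => /andP[xy wyx].
  rewrite xy /=; have [//|/=] := eqVneq y k; rewrite eq_sym => /unlift_some[y' yE _].
  have [xk | ] := eqVneq x k; first by move: wyx; rewrite xk lift_perm_id.
  rewrite eq_sym => /unlift_some[x' xE _]; move: wyx xy.
  rewrite yE xE !lift_perm_lift !perm1 /= /bump !leq0n !add1n ltnS => y'x'.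
  rewrite ltnNge => /negP[]; rewrite leq_add //; last exact: ltnW.
  have [kx|//] := leqP k y'.
  by rewrite (leq_trans kx) // ltnW.
by apply: u_min; rewrite lift_perm_id.
Qed.

Lemma vperm_short k :
  vperm k k = ord_max /\
  forall i j, (i < j)%N -> (vperm k j < vperm k i)%N -> i = k.
Proof.
have last_max : ord_last k = ord_max by apply: val_inj; rewrite /= subn1.
rewrite /vperm; case: arg_minnP => [|u /eqP uk u_min]; first by rewrite tpermL.
rewrite last_max in uk u_min; split=> // i j ij uji.
(* This competitor sends [k] to the last value and is increasing elsewhere, so all its inversions
   start at [k]. *)
pose w := lift_perm k ord_max 1 : 'S_n.
pose A := [set p : 'I_n * 'I_n | (p.1 < p.2)%N && (p.1 == k)]%SET.
suff : (i, j) \in A by rewrite inE => /andP[_ /eqP].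
rewrite -(@inversions_min u w A) ?inE /= ?ij //.
- apply/fintype.subsetP => -[x y]; rewrite !inE /= => /andP[xy /eqP xk].
  rewrite xy xk uk ltn_neqAle -ltnS ltn_ord andbT; apply/negP => /eqP uy.
  have : u y = u k by apply: val_inj; rewrite uk.
  by move/perm_inj => yk; move: xy; rewrite yk xk ltnn.
- apply/fintype.subsetP => -[x y]; rewrite !inE /= => /andP[xy wyx].
  rewrite xy /=; have [//|/=] := eqVneq x k; rewrite eq_sym => /unlift_some[x' xE _].
  have [yk | ] := eqVneq y k.
    by move: wyx; rewrite yk lift_perm_id ltnNge -ltnS ltn_ord.
  rewrite eq_sym => /unlift_some[y' yE _]; move: wyx xy.
  rewrite yE xE !lift_perm_lift !perm1 !lift_max => y'x'.
  rewrite ltnNge => /negP[]; rewrite /= /bump leq_add //; last exact: ltnW.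
  have [kx|//] := leqP k y'.
  by rewrite (leq_trans kx) // ltnW.
by apply: u_min; rewrite lift_perm_id.
Qed.

(** The order-reversing permutation inverts every pair, so a permutation of maximal length does
    too. *)
Lemma longest_permP i j : (i < j)%N -> (longest_perm n j < longest_perm n i)%N.
Proof.
move=> ij; rewrite /longest_perm; case: arg_maxnP => // u _ u_max.
pose r : 'S_n := perm (@rev_ord_inj n).
pose A := [set p : 'I_n * 'I_n | (p.1 < p.2)%N]%SET.
have uA : inversions u \subset A.
  by apply/fintype.subsetP => p; rewrite !inE => /andP[].
have rA : A \subset inversions r.
  apply/fintype.subsetP => -[x y]; rewrite !inE /= => xy; rewrite xy !permE /=.
  by rewrite ltn_sub2l // (leq_ltn_trans _ (ltn_ord y)).
have /eqP : inversions u == A.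
  rewrite eqEcard uA (leq_trans (subset_leq_card rA)) //.
  exact: u_max.
by move=> /setP/(_ (i, j)); rewrite !inE /= ij.
Qed.

Lemma longest_perm_max : longest_perm n ord_max = 0.
Proof.
have [x wx] : exists x, longest_perm n x = 0.
  by exists ((longest_perm n)^-1 0)%g; rewrite permKV.
have [x_max | x_max] := ltnP x n'.
  by have := @longest_permP x ord_max x_max; rewrite wx.
suff <- : x = ord_max by [].
by apply/val_inj/anti_leq; rewrite x_max -ltnS ltn_ord.
Qed.

Definition rev_perm : 'S_n := perm (@rev_ord_inj n).

(** Reversing both positions and values keeps inversions but reflects their ends: those of [vperm m]
    start at [m], so the new ones end at [rev_ord m]. *)
Lemma w0vperm_short m : short_first (rev_perm * w0vperm m)%g (rev_ord m).
Proof.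
have [vm v_inv] := vperm_short m.
split=> [|i j ij]; rewrite /w0vperm !permM !permE /=.
  by rewrite rev_ordK vm longest_perm_max.
set x := rev_ord i; set y := rev_ord j => w_yx.
have yx : (y < x)%N by rewrite /= ltn_sub2l // (leq_ltn_trans _ (ltn_ord j)).
apply: rev_ord_inj; rewrite rev_ordK; apply: (v_inv y x yx).
have [//| ge] := ltnP (vperm m x) (vperm m y).
move: ge; rewrite leq_eqVlt => /orP[/eqP/val_inj/perm_inj e | /longest_permP].
  by move: yx; rewrite e ltnn.
by move=> /(ltn_trans w_yx); rewrite ltnn.
Qed.

End ShortestPermutations.

(** * LU factorization without division *)

Section FractionFreeLU.
Variables (R : comNzRingType) (K : comNzRingType) (ev : {rmorphism R -> K}).

(* Applied to [ev] the evaluation at a point: it factors a matrix of polynomials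
   over all but finitely many points. *)
Lemma fraction_free_lu m (A : 'M[R]_m) : map_mx ev A = 1%:M ->
  exists d : R, exists L U : 'M[R]_m,
    [/\ d *: A = L *m U, is_trig_mx L, is_trig_mx U^T & ev d = 1].
Proof.
elim: m => [|m IHm] in A *.
  exists 1, 1%:M, 1%:M; split; rewrite ?trmx1 ?scalar_mx_is_trig ?rmorph1 //.
  by apply/matrixP => -[].
move: A; rewrite -[m.+1]/(1 + m)%N => A evA.
pose a := A 0 0; pose b := ursubmx A; pose c := dlsubmx A.
have ulE : ulsubmx A = a%:M.
  apply/matrixP => i j; rewrite !ord1 !mxE; congr (A _ _); exact: val_inj.
(* The Schur complement of the pivot [a], multiplied by [a] to avoid division. It again evaluates to
   the identity. *)
pose S := a *: drsubmx A - c *m b.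
have eva : ev a = 1 by have /matrixP/(_ 0 0) := evA; rewrite !mxE.
have evS : map_mx ev S = 1%:M.
  have c0 : map_mx ev c = 0.
    by rewrite map_dlsubmx evA scalar_mx_block block_mxKdl.
  rewrite map_mxB map_mxM c0 mul0mx subr0 map_mxZ eva scale1r.
  by rewrite map_drsubmx evA scalar_mx_block block_mxKdr.
have [d [L [U [dS Lt Ut evd]]]] := IHm S evS.
(* The recursion factors [d *: S], not [S]; the factor [d] in the first block row of the upper
   matrix compensates for this. *)
exists (d * a), (block_mx a%:M 0 c L), (block_mx (d * a)%:M (d *: b) 0 U); split.
- rewrite mulmx_block !mul0mx !mulmx0 !addr0 -[A in LHS]submxK ulE scale_block_mx.
  rewrite -/b -/c; congr block_mx.
  + by rewrite scale_scalar_mx -scalar_mxM mulrC.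
  + by rewrite mul_scalar_mx scalerA mulrC.
  + by rewrite mul_mx_scalar.
  by rewrite -dS scalerBr -scalemxAr scalerA addrC subrK.
- by rewrite is_trig_block_mx // mx11_is_trig Lt eqxx.
- by rewrite tr_block_mx is_trig_block_mx // mx11_is_trig Ut trmx0 eqxx.
- by rewrite rmorphM evd eva mul1r.
Qed.

End FractionFreeLU.

(** * Schubert varieties through polynomial paths of matrices *)

Section FlagPaths.
Variables (K : numFieldType) (n' : nat).
Let n := n'.+1.
Implicit Types (g : GL K n) (i j k b : 'I_n) (u w : 'S_n).

Lemma lead_colsE (R : nzRingType) (A : 'M[R]_n) i : lead_cols A i = A *m lead_cols 1%:M i.
Proof. by rewrite /lead_cols mulmx_colsub mulmx1. Qed.

Lemma lead_cols1E (R : nzRingType) i j (k : 'I_i.+1) :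
  lead_cols (1%:M : 'M[R]_n) i j k = (j == k :> nat)%:R.
Proof. by rewrite !mxE. Qed.

(** [invmx (val g) *m v] lists the coordinates of [v] in the basis of columns of [g]. *)
Lemma col_flagE g i (v : 'cV[K]_n) :
  v \in col_flag (val g) i <-> forall b, (i < b)%N -> (invmx (val g) *m v) b 0 = 0.
Proof.
have gU := valP g; rewrite mem_col_flag; split=> [/submxP[D] | v0].
  move=> /(congr1 trmx); rewrite trmxK trmx_mul trmxK lead_colsE => -> b ib.
  rewrite -mulmxA (mulKmx gU) mxE big1 // => k _.
  by rewrite lead_cols1E gtn_eqF ?mul0r // (leq_trans _ ib) // ltnS -ltnS ltn_ord.
set z := invmx (val g) *m v in v0.
apply/submxP; exists (\row_k z (widen_ord (ltn_ord i) k) 0).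
apply: trmx_inj; rewrite trmxK trmx_mul trmxK lead_colsE -mulmxA.
apply: (can_inj (mulKmx (etrans (unitmx_inv _) gU))); rewrite -/z (mulKmx gU).
apply/colP => b; rewrite [RHS]mxE.
under eq_bigr => k _ do rewrite lead_cols1E [_^T _ _]mxE [(\row__ _) _ _]mxE.
have [bi | ib] := leqP b i.
  rewrite (bigD1 (Ordinal (bi : (b < i.+1)%N))) //= eqxx mul1r big1 ?addr0 => [|k kb].
    by congr (z _ _); apply: val_inj.
  suff /negPf-> : b != k :> nat by rewrite mul0r.
  by rewrite eq_sym; exact: kb.
rewrite v0 // big1 // => k _.
by rewrite gtn_eqF ?mul0r // (leq_trans _ ib) // ltnS -ltnS ltn_ord.
Qed.

Lemma proj_mul_upper g g' (b : 'M[K]_n) :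
  val g = val g' *m b -> upper_tri b -> proj g = proj g'.
Proof.
move=> gE bt; apply: val_inj; apply/ffunP => i.
have /andP[/forallP/(_ i) /eqP dim_g _] := col_flagP g.
have /andP[/forallP/(_ i) /eqP dim_g' _] := col_flagP g'.
apply/eqP; rewrite /= eqEdim dim_g dim_g' leqnn andbT.
apply/subvP => v /col_flagE v0; apply/col_flagE => r ir.
have -> : invmx (val g') *m v = b *m (invmx (val g) *m v).
  by rewrite -{1}[v](mulKVmx (valP g)) {1}gE -mulmxA (mulKmx (valP g')).
rewrite mxE big1 // => k _; have [ki | ik] := leqP k i; last by rewrite v0 // mulr0.
have /is_trig_mxP/(_ k r) := bt; rewrite mxE => -> //; first by rewrite mul0r.
exact: leq_ltn_trans ir.
Qed.

Definition to_GL (A : 'M[K]_n) (AU : A \in unitmx) : GL K n := exist _ A AU.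

Lemma poly_vanish (p : {poly K}) : (forall t, p.[t] = 0) -> p = 0.
Proof.
move=> p0; apply/eqP; apply: contraT => pn0.
(* In characteristic zero these [size p] roots are distinct, one more than a nonzero [p] can
   have. *)
pose rs : seq K := [seq m%:R | m <- iota 0 (size p)].
suff : (size rs < size p)%N by rewrite size_map size_iota ltnn.
apply: max_poly_roots pn0 _ _; first by apply/allP => x _; apply/rootP.
by rewrite map_inj_uniq ?iota_uniq //; apply: mulrIn; apply: oner_neq0.
Qed.

Definition mx_at (A : 'M[{poly K}]_n) (t : K) : 'M[K]_n := map_mx (horner_eval t) A.

Lemma eval_at_path (f : zpoly K n) (A : 'M[{poly K}]_n) :
  exists p : {poly K}, forall t, p.[t] = eval_at f (mx_at A t).
Proof.
exists (mmap polyC (mxvec A 0) f) => t.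
rewrite /eval_at /meval /mmap -horner_evalE rmorph_sum; apply: eq_bigr => m _.
rewrite rmorphM /= horner_evalE hornerC; congr (_ * _).
rewrite /mmap1 rmorph_prod; apply: eq_bigr => k _; rewrite rmorphXn /=; congr (_ ^+ _).
by case/mxvec_indexP: k => i j; rewrite !mxvecE mxE.
Qed.

(** An equation of [F] restricts to a polynomial in [t]; its product with [d] vanishes at every [t],
    hence so does the equation at [t0]. *)
Lemma closed_path (F : set (flag K n)) (A : 'M[{poly K}]_n) (d : {poly K}) t0 g :
  closed_flags F -> d != 0 -> val g = mx_at A t0 ->
  (forall t, d.[t] != 0 -> exists2 g', val g' = mx_at A t & F (proj g')) ->
  F (proj g).
Proof.
move=> [P FP] d0 gE FA; apply/FP => f Pf; rewrite gE.
have [p pE] := eval_at_path f A.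
suff p0 : p = 0 by rewrite -pE p0 horner0.
suff : p * d = 0 by move=> /eqP; rewrite mulf_eq0 (negPf d0) orbF => /eqP.
apply: poly_vanish => t; rewrite hornerM; have [->|dt] := eqVneq d.[t] 0.
  by rewrite mulr0.
by have [g' g'E /FP/(_ f Pf)] := FA t dt; rewrite pE -g'E => ->; rewrite mul0r.
Qed.

(** The line from the permutation matrix at 0 to [r0] at 1. A generic point factors as [L U] times
    the permutation matrix, and moving this matrix to the left of [U] conjugates [U] into [M]. *)
Lemma dotmx_path u k (r0 : 'M[K]_n) : short_first u k ->
  r0 \in unitmx -> (forall j, (j < k)%N -> r0 0 j = 0) ->
  exists A : 'M[{poly K}]_n, exists d : {poly K},
    [/\ mx_at A 1 = r0, d != 0 & forall t, d.[t] != 0 ->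
      mx_at A t \in unitmx /\ exists L M : 'M[K]_n,
        [/\ lower_tri L, upper_tri M & mx_at A t = L *m Defs.dotmx K u *m M]].
Proof.
move=> [uk u_inv] r0U r00.
pose A : 'M[{poly K}]_n :=
  \matrix_(i, j) ((1 - 'X) * (u j == i)%:R%:P + 'X * (r0 i j)%:P).
have AtE t i j : mx_at A t i j = (1 - t) * (u j == i)%:R + t * r0 i j.
  by rewrite !mxE /horner_eval !hornerE.
have A0 : mx_at A 0 = Defs.dotmx K u.
  by apply/matrixP => i j; rewrite AtE mxE subr0 mul1r mul0r addr0.
(* [A'] is [A] times the inverse of the permutation matrix: the zeros of the first
   row of its upper factor are those that conjugation by [u] moves below the
   diagonal. *)
pose A' : 'M[{poly K}]_n := col_perm u^-1%g A.
have A'0 : map_mx (horner_eval 0) A' = 1%:M.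
  rewrite map_col_perm -[map_mx _ _]/(mx_at A 0) A0.
  by apply/matrixP => i j; rewrite !mxE permKV eq_sym.
have [d [L [U [dA Lt Ut d0]]]] := fraction_free_lu A'0.
(* Where this polynomial is nonzero the factorization holds and the path is in [GL]. At 0 its value
   is the determinant of a permutation matrix. *)
exists A, (d * \det A); split.
- by apply/matrixP => i j; rewrite AtE subrr mul0r add0r mul1r.
- apply/eqP => /(congr1 (horner_eval 0)); rewrite rmorphM d0 mul1r rmorph0 -det_map_mx.
  rewrite -[map_mx _ _]/(mx_at A 0) A0 dotmx_perm => /eqP; apply/negP.
  by rewrite -unitfE -unitmxE unitmx_perm.
move=> t; rewrite hornerM mulf_eq0 negb_or => /andP[dt At].
have AtU : mx_at A t \in unitmx by rewrite unitmxE unitfE det_map_mx.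
split=> //; pose Lt' := mx_at L t; pose Ut' := mx_at U t.
have A'E : d.[t] *: mx_at A' t = Lt' *m Ut'.
  by rewrite -map_mxM -dA map_mxZ.
have AE i j : d.[t] * mx_at A t i j = (Lt' *m Ut') i (u j).
  by rewrite -A'E !mxE permK.
have Lt't : is_trig_mx Lt'.
  by apply/is_trig_mxP => i j ij; rewrite mxE (is_trig_mxP Lt) // rmorph0.
have Ut't i j : (j < i)%N -> Ut' i j = 0.
  by move=> ji; have /is_trig_mxP/(_ j i ji) := Ut; rewrite !mxE => ->; rewrite rmorph0.
have Lt'U : Lt' \in unitmx.
  suff : Lt' *m Ut' \in unitmx by rewrite unitmx_mul => /andP[].
  rewrite -A'E unitmxZ ?unitfE // unitmxE.
  have -> : mx_at A' t = col_perm u^-1%g (mx_at A t) by rewrite /mx_at map_col_perm.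
  by rewrite -unitmxE col_permE unitmx_mul AtU unitmx_perm.
(* Row 0 of the lower factor is its diagonal entry alone, a unit, so zeros of the first row of the
   path pass to the upper factor. *)
have U0 j : (j < k)%N -> Ut' 0 (u j) = 0.
  move=> jk; have := AE 0 j; rewrite AtE r00 // mulr0 addr0.
  have /negPf-> : u j != 0.
    by apply/eqP; rewrite -uk => /perm_inj jk'; move: jk; rewrite jk' ltnn.
  rewrite !mulr0 mxE (bigD1 0) //= big1 ?addr0 => [|l l0].
    move=> /esym/eqP; rewrite mulf_eq0 => /orP[/eqP L0 | /eqP //].
    by have := unitmx_trig_diag 0 Lt't Lt'U; rewrite L0 unitr0.
  by rewrite (is_trig_mxP Lt't) ?mul0r // lt0n.
pose M : 'M[K]_n := \matrix_(c, j) (d.[t]^-1 * Ut' (u c) (u j)).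
have ME c j : M c j = d.[t]^-1 * Ut' (u c) (u j) by rewrite mxE.
exists Lt', M; split=> //.
- apply/is_trig_mxP => j c jc; rewrite [LHS]mxE ME.
  have [uc | uc] := ltnP (u j) (u c); first by rewrite Ut't ?mulr0.
  have ucj : (u c < u j)%N.
    rewrite ltn_neqAle uc andbT; apply/negP => /eqP/val_inj/perm_inj cj.
    by move: jc; rewrite cj ltnn.
  (* The remaining entries sit at inversions of [u]; these end at [k], so the entries come from row
     [u k = 0] of the upper factor. *)
  have ck := u_inv j c jc ucj; rewrite ck uk.
  by rewrite U0 ?mulr0 // -ck.
apply/matrixP => i j; apply: (mulfI dt).
rewrite AE dotmx_perm -mulmxA mxE -row_permE [X in _ = _ * X]mxE.
rewrite mulr_sumr; apply: eq_bigr => c _.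
by rewrite [row_perm _ _ _ _]mxE ME permKV mulrCA mulVKf.
Qed.

(** The range of [proj] is closed, being cut out by no equation at all. Points of closures thus get
    a matrix without proving that every flag comes from one. *)
Lemma flag_closure_proj (C : set (flag K n)) V : C `<=` range (@proj K n) ->
  flag_closure C V -> exists g, V = proj g.
Proof.
move=> C_proj V_cl.
have proj_closed : closed_flags (range (@proj K n)).
  by exists set0 => g; split=> [_ f [] | _]; exists g.
have [g _ <-] := V_cl (range (@proj K n)) proj_closed C_proj.
by exists g.
Qed.

Lemma opp_schubertP u k g : short_first u k ->
  opp_schubert u (proj g) <-> forall j, (j < k)%N -> val g 0 j = 0.
Proof.
move=> u_short; split=> [g_cl | g0].
  (* The condition on [g] is restated on the flag, to be closed in the sense of [closed_flags] and
     checked on the cell. *)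
  pose F := [set V : flag K n |
    forall j, (j < k)%N -> forall v : 'cV[K]_n, v \in val V j -> v 0 0 = 0].
  have FE g' : F (proj g') <-> forall j, (j < k)%N -> val g' 0 j = 0.
    split=> [Fg' j jk | g'0 j jk v /col_flagE v0].
      have := Fg' j jk (col j (val g')); rewrite [col _ _ _ _]mxE; apply.
      apply/col_flagE => b jb; rewrite colE (mulKmx (valP g')) !mxE.
      by rewrite -val_eqE gtn_eqF.
    rewrite -[v](mulKVmx (valP g')) mxE big1 // => l _.
    have [lj | jl] := leqP l j; last by rewrite v0 ?mulr0.
    by rewrite g'0 ?mul0r // (leq_ltn_trans lj).
  apply/FE; apply: (g_cl F).
    exists [set 'X_(mxvec_index 0 j) | j in [set j : 'I_n | (j < k)%N]] => g'.
    apply: (iff_trans (FE g')); split=> [g'0 _ [j jk <-] | g'0 j jk].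
      by rewrite /eval_at mevalXU mxvecE g'0.
    have := g'0 _ (ex_intro2 _ _ j jk erefl).
    by rewrite /eval_at mevalXU mxvecE.
  move=> _ [g' [L [Lt g'E ->]]]; apply/FE => j jk; rewrite g'E mxE big1 // => l _.
  rewrite mxE; have [uj | _] := eqVneq; last by rewrite mulr0.
  have [l0 | l0] := posnP l; last by rewrite (is_trig_mxP Lt) ?mul0r.
  have : u j = u k by rewrite u_short.1 uj; apply: val_inj.
  by move/perm_inj => jk'; move: jk; rewrite jk' ltnn.
have [A [d [A1 d0 A_cell]]] := dotmx_path u_short (valP g) g0.
move=> F F_closed F_cell; apply: (closed_path F_closed d0 (esym A1)) => t dt.
have [AU [L [M [Lt Mt AE]]]] := A_cell t dt.
exists (to_GL AU) => //; apply: F_cell.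
have LU : L *m Defs.dotmx K u \in unitmx.
  by move: AU; rewrite AE unitmx_mul => /andP[].
exists (to_GL LU), L; split=> //.
exact: (@proj_mul_upper (to_GL AU) (to_GL LU) M AE Mt).
Qed.

Lemma adj_invmx (X : 'M[K]_n) : X \in unitmx -> \adj X = \det X *: invmx X.
Proof. by move=> XU; rewrite /invmx XU scalerA divff ?scale1r // -unitfE -unitmxE. Qed.

Lemma schubertP w m g : short_first (rev_perm n' * w)%g (rev_ord m) ->
  schubert w (proj g) <-> forall b, (m < b)%N -> invmx (val g) b 0 = 0.
Proof.
set u := (rev_perm n' * w)%g => u_short; split=> [g_cl | g0].
  (* The vanishing of the last entries in the first column of the inverse says that [V_m] contains
     the first basis vector. *)
  pose F := [set V : flag K n | delta_mx 0 0 \in val V m].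
  have FE g' : F (proj g') <-> forall b, (m < b)%N -> invmx (val g') b 0 = 0.
    split=> [/col_flagE g'0 b mb | g'0].
      by have := g'0 b mb; rewrite -colE mxE.
    by apply/col_flagE => b mb; rewrite -colE mxE g'0.
  apply/FE; apply: (g_cl F).
    (* The adjugate replaces the inverse, whose entries are not polynomials; they differ by the
       determinant, which is nonzero on [GL]. *)
    exists [set \adj (zmx K n) b 0 | b in [set b : 'I_n | (m < b)%N]] => g'.
    have adjE b : eval_at (\adj (zmx K n) b 0) (val g') = \det (val g') * invmx (val g') b 0.
      have -> : eval_at (\adj (zmx K n) b 0) (val g') = \adj (val g') b 0.
        transitivity (map_mx (meval (mxvec (val g') 0)) (\adj (zmx K n)) b 0).
          by rewrite [RHS]mxE.
        rewrite map_mx_adj; congr (\adj _ _ _).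
        by apply/matrixP => i j; rewrite 2!mxE [LHS]mevalXU mxvecE.
      by rewrite (adj_invmx (valP g')) mxE.
    have det0 : \det (val g') != 0 by rewrite -unitfE -unitmxE (valP g').
    apply: (iff_trans (FE g')); split=> [g'0 _ [b mb <-] | g'0 b mb].
      by rewrite adjE g'0 // mulr0.
    have := g'0 _ (ex_intro2 _ _ b mb erefl).
    by rewrite adjE => /eqP; rewrite mulf_eq0 (negPf det0) => /eqP.
  move=> _ [g' [U [Ut g'E ->]]]; rewrite /F /=; apply/col_flagE => b mb.
  have wm : w m = 0 by have := u_short.1; rewrite permM permE rev_ordK.
  have [x Ux] : exists x, delta_mx 0 0 = x *: (val g' *m delta_mx m 0) :> 'cV[K]_n.
    have colg : val g' *m delta_mx m 0 = U 0 0 *: delta_mx 0 0 :> 'cV[K]_n.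
      rewrite -colE g'E; apply/colP => i; rewrite !mxE (bigD1 0) //= big1 ?addr0 => [|l l0].
        rewrite mxE wm eqxx mulr1 andbT; have [-> | i0] := eqVneq i 0.
          by rewrite mulr1.
        have /is_trig_mxP/(_ 0 i) := Ut; rewrite mxE mulr0 => -> //.
        by rewrite lt0n.
      by rewrite mxE wm eq_sym (negPf l0) mulr0.
    exists (U 0 0)^-1; rewrite colg scalerA mulVf ?scale1r //; apply/eqP => U00.
    have : delta_mx m 0 = 0 :> 'cV[K]_n.
      by rewrite -[LHS](mulKmx (valP g')) colg U00 scale0r mulmx0.
    by move/colP/(_ m)/eqP; rewrite !mxE !eqxx oner_eq0.
  rewrite Ux -scalemxAr (mulKmx (valP g')) !mxE -val_eqE gtn_eqF ?mulr0 //.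
pose J : 'M[K]_n := perm_mx (rev_perm n').
have JT : J^T = J.
  by apply/matrixP => i j; rewrite !mxE !permE -(inj_eq rev_ord_inj) rev_ordK eq_sym.
have JJ : J *m J = 1%:M.
  by rewrite -{1}JT tr_perm_mx -perm_mxM mulVg perm_mx1.
have JU : J \in unitmx by rewrite unitmx_perm.
have JXJ (X : 'M[K]_n) i j : (J *m X *m J) i j = X (rev_ord i) (rev_ord j).
  by rewrite -row_permE -[J in _ *m J]JT tr_perm_mx -col_permE !mxE !permE.
have wu : Defs.dotmx K w *m J = Defs.dotmx K u.
  by rewrite !dotmx_perm /u invMg perm_mxM -(tr_perm_mx _ (rev_perm n')) -/J JT.
have gU := valP g; set G := val g in gU g0.
have invE (X Y : 'M[K]_n) : Y *m X = 1%:M -> invmx X = Y.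
  by move=> YX; have [_ XU] := mulmx1_unit YX; rewrite -[LHS]mul1mx -YX mulmxK.
(* The first row of [r0] is the first column of the inverse of [G] read backwards, so [dotmx_path]
   applies to it with [u] and [rev_ord m]. *)
pose r0 : 'M[K]_n := (invmx G)^T *m J.
have r0U : r0 \in unitmx by rewrite unitmx_mul unitmx_tr unitmx_inv gU JU.
have r00 j : (j < rev_ord m)%N -> r0 0 j = 0.
  move=> jm; have -> : r0 0 j = invmx G (rev_ord j) 0.
    by rewrite /r0 -[J]JT tr_perm_mx -col_permE !mxE permE.
  apply: g0; move: jm; rewrite /= !ltn_subRL.
  by rewrite addSn addnC -addSn.
have [A [d [A1 d0 A_cell]]] := dotmx_path u_short r0U r00.
(* The inverse of [A] up to a scalar, which does not change the flags. *)
pose B : 'M[{poly K}]_n := (\adj A)^T *m map_mx polyC J.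
have BE t : mx_at A t \in unitmx ->
    mx_at B t = \det (mx_at A t) *: (invmx (mx_at A t)^T *m J).
  move=> AU; rewrite /mx_at map_mxM -map_trmx map_mx_adj -/(mx_at A t) adj_invmx //.
  rewrite linearZ -trmx_inv -scalemxAl; congr (_ *: (_ *m _)).
  by apply/matrixP => i j; rewrite 2!mxE [LHS]hornerC.
have BU t : mx_at A t \in unitmx -> mx_at B t \in unitmx.
  move=> AU; rewrite BE // unitmxZ; first by rewrite unitmx_mul unitmx_inv unitmx_tr AU JU.
  by rewrite -unitmxE.
have A1U : mx_at A 1 \in unitmx by rewrite A1.
pose g1 := to_GL (BU 1 A1U).
have -> : proj g = proj g1.
  apply/esym/(@proj_mul_upper _ _ (\det r0)%:M); last first.
    by rewrite /upper_tri tr_scalar_mx scalar_mx_is_trig.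
  rewrite /= BE // A1 mul_mx_scalar; congr (_ *: _).
  rewrite (invE _ (G *m J)) -?mulmxA ?JJ ?mulmx1 //.
  by rewrite /r0 trmx_mul JT trmxK [J *m (J *m _)]mulmxA JJ mul1mx mulmxV.
move=> F F_closed F_cell.
apply: (closed_path F_closed d0 (erefl : val g1 = mx_at B 1)) => t dt.
have [AU [L [M [Lt Mt AE]]]] := A_cell t dt.
exists (to_GL (BU t AU)) => //; apply: F_cell.
have [LU uU MU] : [/\ L \in unitmx, Defs.dotmx K u \in unitmx & M \in unitmx].
  by move: AU; rewrite AE !unitmx_mul => /andP[/andP[-> ->] ->].
have wU : Defs.dotmx K w \in unitmx by rewrite dotmx_perm unitmx_perm.
have hU : invmx L^T *m Defs.dotmx K w \in unitmx.
  by rewrite unitmx_mul unitmx_inv unitmx_tr LU wU.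
exists (to_GL hU), (invmx L^T); split=> //.
  by rewrite /upper_tri trmx_inv trmxK trig_invmx.
(* Inverse transposition of [L u M] gives [L^-T u M^-T]. As [w J = u], a further [J] on the right
   yields [L^-T w (J M^-T J)], and conjugation by [J] makes the lower triangular [M^-T] upper
   triangular. *)
apply: (@proj_mul_upper _ _ (\det (mx_at A t) *: (J *m invmx M^T *m J))).
  rewrite /= BE // -scalemxAr; congr (_ *: _).
  rewrite !mulmxA -[_ *m Defs.dotmx K w *m J]mulmxA wu; congr (_ *m J).
  apply: invE; rewrite AE !trmx_mul.
  rewrite -!mulmxA (mulKmx (_ : M^T \in unitmx)) ?unitmx_tr //.
  have uT : Defs.dotmx K u *m (Defs.dotmx K u)^T = 1%:M.
    by rewrite dotmx_perm tr_perm_mx invgK -perm_mxM mulVg perm_mx1.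
  by rewrite [Defs.dotmx K u *m _]mulmxA uT mul1mx mulVmx ?unitmx_tr.
apply/is_trig_mxP => i j ij; rewrite 2!mxE JXJ.
have MTt : is_trig_mx (invmx M^T) by rewrite trig_invmx ?unitmx_tr.
rewrite (is_trig_mxP MTt) ?mulr0 //= ltn_sub2l //.
exact: leq_ltn_trans (ltn_ord j).
Qed.

(** * Points of the Hessenberg scheme *)

Lemma hess_varietyP (h : 'I_n -> 'I_n) g : hessenberg h ->
  hess_variety (diag_e1 K n) h (proj g) <->
  forall i b, (h i < b)%N -> val g 0 i * invmx (val g) b 0 = 0.
Proof.
move=> hh; rewrite diag_e1E.
have actE (v : 'cV[K]_n) b :
    (invmx (val g) *m (delta_mx 0 0 *m v)) b 0 = v 0 0 * invmx (val g) b 0.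
  have -> : delta_mx 0 0 *m v = v 0 0 *: delta_mx 0 0 :> 'cV[K]_n.
    apply/colP => i; rewrite !mxE (bigD1 0) //= big1 ?addr0 => [|l l0]; rewrite !mxE.
      by rewrite !andbT mulrC.
    by rewrite (negPf l0) andbF mul0r.
  by rewrite -scalemxAr -colE !mxE.
split=> [Vg i b hb | g0 i v /col_flagE v0].
  have : col i (val g) \in col_flag (val g) i.
    apply/col_flagE => c ic; rewrite colE (mulKmx (valP g)) !mxE.
    by rewrite -val_eqE gtn_eqF.
  by move=> /(Vg i)/col_flagE/(_ b hb); rewrite actE mxE.
apply/col_flagE => b hb; rewrite actE.
rewrite -[v](mulKVmx (valP g)) mxE mulr_suml big1 // => l _.
have [li | il] := leqP l i; last by rewrite v0 ?mulr0 ?mul0r.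
rewrite mulrAC g0 ?mul0r //.
exact: leq_ltn_trans (hessenberg_mono hh li) hb.
Qed.

(** With [k] the first nonzero position in the first row of [g], the corner is the least [i] with
    [h i = h k]: it is at most [k], and the products with the nonzero entry [k] force the second
    condition. *)
Lemma hess_products_corner (h : 'I_n -> 'I_n) g : hessenberg h ->
  (forall i b, (h i < b)%N -> val g 0 i * invmx (val g) b 0 = 0) <->
  exists2 i, corners h i &
    (forall j, (j < i)%N -> val g 0 j = 0) /\
    (forall b, (h i < b)%N -> invmx (val g) b 0 = 0).
Proof.
move=> hh; split=> [g0 | [i _ [gi0 gh0]] j b hb]; last first.
  have [ji | ij] := ltnP j i; first by rewrite gi0 // mul0r.
  by rewrite gh0 ?mulr0 // (leq_ltn_trans (hessenberg_mono hh ij)).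
have [j0 gj0] : exists j, val g 0 j != 0.
  apply/existsP; apply: contraT; rewrite negb_exists => /forallP gz.
  have := mulmxV (valP g) => /matrixP/(_ 0 0)/eqP.
  rewrite !mxE eqxx big1 ?(eq_sym 0) ?oner_eq0 // => l _.
  by have := gz l; rewrite negbK => /eqP->; rewrite mul0r.
case: (@arg_minnP _ j0 (fun j => val g 0 j != 0) (@nat_of_ord n) gj0) => k gk k_min.
case: (@arg_minnP _ k (fun i => h i == h k) (@nat_of_ord n) (eqxx _)) => i /eqP hik i_min.
exists i; [|split].
- move=> j ij; rewrite ltn_neqAle (hh.2 j i ij) andbT; apply/negP => /eqP/val_inj hj.
  by have := i_min j; rewrite hj hik eqxx ij ltnn => /(_ isT).
- move=> j ji; apply/eqP; apply: contraT => /k_min kj.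
  have := i_min k (eqxx _); move=> ik.
  by have := leq_ltn_trans (leq_trans ik kj) ji; rewrite ltnn.
move=> b; rewrite hik => /(g0 k b)/eqP; rewrite mulf_eq0 (negPf gk) => /eqP//.
Qed.

Lemma hess_points (h : 'I_n -> 'I_n) : hessenberg h ->
  subscheme_points (hess_ideal (diag_e1 K n) h) =
  \bigcup_(i in corners h) @richardson K n (uperm i) (w0vperm (h i)).
Proof.
move=> hh; apply/seteqP; split=> [V [g] | V [i hi [V_op V_sch]]].
  move=> /vanish_hess_ideal/(hess_varietyP _ hh)/(hess_products_corner _ hh).
  move=> [i hi [gi0 gh0]] <-; exists i => //; split.
    by apply/(opp_schubertP _ (uperm_short i)).
  by apply/(schubertP _ (w0vperm_short (h i))).
have [g VE] : exists g, V = proj g.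
  by apply: flag_closure_proj V_sch => _ [g [b [_ _ ->]]]; exists g.
rewrite VE in V_op V_sch *; exists g => //.
apply/vanish_hess_ideal/(hess_varietyP _ hh)/(hess_products_corner _ hh).
exists i => //; split.
  exact/(opp_schubertP _ (uperm_short i)).
exact/(schubertP _ (w0vperm_short (h i))).
Qed.

End FlagPaths.

Theorem theorem1 (R : realType) (n : nat) (hn : (1 <= n)%N)
    (h : 'I_n -> 'I_n) (hh : hessenberg h) :
  let Y := hess_ideal (diag_e1 R[i] n) h in
  subscheme_reduced Y /\
  subscheme_points Y =
    \bigcup_(i in corners h) richardson (uperm i) (w0vperm (h i)).
Proof.
case: n hn h hh => // n' _ h hh Y; split; last exact: hess_points.
by move=> w; apply: chart_hess_radical.
Qed.
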